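(* Let $\mathcal{A}$ be a class of weakly-archimedean, linearly ordered $FL_{ew}$-algebras such that for every $n\in\omega$ there is some $\mathbf{A}_n\in\mathcal{A}$ which is not $n$-contractive (i.e. there is $a\in A_n$ with $a^{n+1}<a^n$). Then: (i) the problem of deciding, given a finite set of modal formulas $\Gamma$ and a modal formula $\varphi$, whether $\Gamma\vdash_{4\mathcal{K}_{\mathcal{A}}}\varphi$ is undecidable; (ii) the problem of deciding, given finite $\Gamma$ and $\varphi$, whether $\Gamma\vdash_{\omega4\mathcal{K}_{\mathcal{A}}}\varphi$ is undecidable; (iii) both problems remain undecidable when restricted to formulas built from only three propositional variables.
   Context: An $FL_{ew}$-algebra is a structure $\mathbf{A}=\langle A;\wedge,\vee,\cdot,\to,0,1\rangle$ such that $\langle A;\wedge,\vee,0,1\rangle$ is a bounded lattice, $\langle A;\cdot,1\rangle$ is a commutative monoid, and $a\cdot b\le c$ iff $a\le b\to c$. We write $a^n$ for the $n$-fold product ($a^0=1$). $\mathbf{A}$ is $n$-contractive if $a^{n+1}=a^n$ for all $a\in A$; it is weakly-archimedean if for all $a,b\in A$, $a\le b^n$ for all $n\in\omega$ implies $ab=a$. Modal formulas are built from a countable set of propositional variables using $\wedge,\vee,\cdot,\to,0,1$ and unary $\Box,\Diamond$; $x\leftrightarrow y:=(x\to y)\cdot(y\to x)$, $\neg x:=x\to 0$. An $\mathbf{A}$-Kripke model is $\mathfrak{M}=\langle W,R,e\rangle$ with $W\neq\emptyset$, $R\subseteq W\times W$ and $e$ assigning to each variable and world an element of $A$, extended world-wise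 homomorphically for the propositional connectives and by $e(v,\Box\varphi)=\bigwedge_{Rvw}e(w,\varphi)$, $e(v,\Diamond\varphi)=\bigvee_{Rvw}e(w,\varphi)$ (when these exist). The model is safe if these infima/suprema always exist. $\mathcal{K}_{\mathcal{A}}$ is the class of safe Kripke models over algebras in $\mathcal{A}$; $4\mathcal{K}_{\mathcal{A}}$ is its subclass of models with transitive $R$; $\omega4\mathcal{K}_{\mathcal{A}}$ is the subclass of finite models (finite $W$) in $4\mathcal{K}_{\mathcal{A}}$. For a class $\mathcal{C}$ of models, $\Gamma\vdash_{\mathcal{C}}\varphi$ (local consequence) means: for every $\mathfrak{M}\in\mathcal{C}$ and every world $v$, if $e(v,\gamma)=1$ for all $\gamma\in\Gamma$ then $e(v,\varphi)=1$. *)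

(* Defs.v *)
From Stdlib Require Import List PeanoNat.
Import ListNotations.

Record FLew : Type := {
  car :> Type;
  meet : car -> car -> car;
  join : car -> car -> car;
  mul : car -> car -> car;
  imp : car -> car -> car;
  zero : car;
  one : car;
  meet_assoc : forall a b c, meet a (meet b c) = meet (meet a b) c;
  join_assoc : forall a b c, join a (join b c) = join (join a b) c;
  meet_comm : forall a b, meet a b = meet b a;
  join_comm : forall a b, join a b = join b a;
  meet_absorb : forall a b, meet a (join a b) = a;
  join_absorb : forall a b, join a (meet a b) = a;
  zero_bot : forall a, meet zero a = zero;
  one_top : forall a, meet a one = a;
  mul_assoc : forall a b c, mul a (mul b c) = mul (mul a b) c;
  mul_comm : forall a b, mul a b = mul b a;
  mul_one : forall a, mul a one = a;
  residuation : forall a b c, meet (mul a b) c = mul a b <-> meet a (imp b c) = a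
}.

Definition le (X : FLew) (a b : X) : Prop := meet X a b = a.

Fixpoint pw (X : FLew) (a : X) (n : nat) : X :=
  match n with 0 => one X | S n => mul X a (pw X a n) end.

Definition linearly_ordered (X : FLew) : Prop := forall a b : X, le X a b \/ le X b a.

Definition n_contractive (n : nat) (X : FLew) : Prop :=
  forall a : X, pw X a (S n) = pw X a n.

Definition weakly_archimedean (X : FLew) : Prop :=
  forall a b : X, (forall n, le X a (pw X b n)) -> mul X a b = a.

Inductive form : Type :=
| Var : nat -> form
| FZero : form
| FOne : form
| FAnd : form -> form -> form
| FOr : form -> form -> form
| FProd : form -> form -> form
| FImp : form -> form -> form
| FBox : form -> form
| FDia : form -> form.

Fixpoint vars_below (k : nat) (f : form) : Prop :=
  match f with
  | Var n => n < k
  | FZero | FOne => True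
  | FAnd a b | FOr a b | FProd a b | FImp a b => vars_below k a /\ vars_below k b
  | FBox a | FDia a => vars_below k a
  end.

Definition is_inf (X : FLew) (P : X -> Prop) (a : X) : Prop :=
  (forall b, P b -> le X a b) /\ (forall c, (forall b, P b -> le X c b) -> le X c a).

Definition is_sup (X : FLew) (P : X -> Prop) (a : X) : Prop :=
  (forall b, P b -> le X b a) /\ (forall c, (forall b, P b -> le X b c) -> le X a c).

(* ev X W R e f v a  :  "e(v, f) is defined and equals a" *)
Fixpoint ev (X : FLew) (W : Type) (R : W -> W -> Prop) (e : nat -> W -> X)
  (f : form) (v : W) (a : X) {struct f} : Prop :=
  match f with
  | Var n => a = e n v
  | FZero => a = zero X
  | FOne => a = one X
  | FAnd f1 f2 => exists b c, ev X W R e f1 v b /\ ev X W R e f2 v c /\ a = meet X b c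
  | FOr f1 f2 => exists b c, ev X W R e f1 v b /\ ev X W R e f2 v c /\ a = join X b c
  | FProd f1 f2 => exists b c, ev X W R e f1 v b /\ ev X W R e f2 v c /\ a = mul X b c
  | FImp f1 f2 => exists b c, ev X W R e f1 v b /\ ev X W R e f2 v c /\ a = imp X b c
  | FBox f1 => is_inf X (fun b => exists w, R v w /\ ev X W R e f1 w b) a
  | FDia f1 => is_sup X (fun b => exists w, R v w /\ ev X W R e f1 w b) a
  end.

(* safe: all the required infima/suprema exist, i.e. every formula gets a value *)
Definition safe (X : FLew) (W : Type) (R : W -> W -> Prop) (e : nat -> W -> X) : Prop :=
  forall f v, exists a, ev X W R e f v a.

Definition transitive_rel (W : Type) (R : W -> W -> Prop) : Prop :=
  forall u v w, R u v -> R v w -> R u w.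

Definition finite_type (W : Type) : Prop := exists l : list W, forall w, In w l.

Definition cons_4K (A : FLew -> Prop) (G : list form) (phi : form) : Prop :=
  forall (X : FLew) (W : Type) (R : W -> W -> Prop) (e : nat -> W -> X),
    A X -> inhabited W -> safe X W R e -> transitive_rel W R ->
    forall v, (forall g, In g G -> ev X W R e g v (one X)) -> ev X W R e phi v (one X).

Definition cons_w4K (A : FLew -> Prop) (G : list form) (phi : form) : Prop :=
  forall (X : FLew) (W : Type) (R : W -> W -> Prop) (e : nat -> W -> X),
    A X -> inhabited W -> finite_type W -> safe X W R e -> transitive_rel W R ->
    forall v, (forall g, In g G -> ev X W R e g v (one X)) -> ev X W R e phi v (one X).

Inductive instr : Type :=
| INC : nat -> instr
| DEC : nat -> nat -> instr.

Definition program := list instr.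
Definition mstate : Type := (nat * (nat -> nat))%type.

Definition upd (regs : nat -> nat) (r x : nat) : nat -> nat :=
  fun r' => if Nat.eqb r' r then x else regs r'.

Definition step (P : program) (s : mstate) : option mstate :=
  let (pc, regs) := s in
  match nth_error P pc with
  | None => None
  | Some (INC r) => Some (S pc, upd regs r (S (regs r)))
  | Some (DEC r j) =>
      match regs r with
      | 0 => Some (j, regs)
      | S x => Some (S pc, upd regs r x)
      end
  end.

Fixpoint run (P : program) (k : nat) (s : mstate) : option mstate :=
  match k with
  | 0 => None
  | S k => match step P s with None => Some s | Some s' => run P k s' end
  end.

Definition init (n : nat) : mstate := (0, fun r => if Nat.eqb r 0 then n else 0).

Definition halts_with (P : program) (n m : nat) : Prop :=
  exists k s, run P k (init n) = Some s /\ snd s 0 = m.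

Definition cpair (x y : nat) : nat := (x + y) * (x + y + 1) / 2 + y.

Fixpoint enc_form (f : form) : nat :=
  match f with
  | Var n => cpair 0 n
  | FZero => cpair 1 0
  | FOne => cpair 2 0
  | FAnd a b => cpair 3 (cpair (enc_form a) (enc_form b))
  | FOr a b => cpair 4 (cpair (enc_form a) (enc_form b))
  | FProd a b => cpair 5 (cpair (enc_form a) (enc_form b))
  | FImp a b => cpair 6 (cpair (enc_form a) (enc_form b))
  | FBox a => cpair 7 (enc_form a)
  | FDia a => cpair 8 (enc_form a)
  end.

Fixpoint enc_list (l : list form) : nat :=
  match l with
  | [] => 0
  | f :: l => S (cpair (enc_form f) (enc_list l))
  end.

Definition enc_input (G : list form) (phi : form) : nat := cpair (enc_list G) (enc_form phi).

Definition decidable_on (D : list form -> form -> Prop)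
  (S : list form -> form -> Prop) : Prop :=
  exists P : program, forall G phi, D G phi ->
    (S G phi -> halts_with P (enc_input G phi) 1) /\
    (~ S G phi -> halts_with P (enc_input G phi) 0).

Definition all_inputs (G : list form) (phi : form) : Prop := True.

Definition three_var_inputs (G : list form) (phi : form) : Prop :=
  (forall g, In g G -> vars_below 3 g) /\ vars_below 3 phi.

(* Main.v *)
From Stdlib Require Import List PeanoNat Lia Classical IndefiniteDescription
  FunctionalExtensionality Cantor.
Require Import Defs.
Import ListNotations.

(** Fix a value [x] and read the powers [y = x ^ Y], [z = x ^ Z] at a world as a pair of
    numbers, i.e. of words in bijective base 2.  On a transitive chain on which [y] and [z]
    decrease towards the root, [FBox y] and [FBox z] are their values at the next world, so a
    formula can say that every world appends some pair [(u, v)] of a finite list to the words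
    [Z] and [Y] of the next world; the root compares the two words.  Weak archimedeanity
    bounds the exponents whenever the goal [s -> x s], where [s = FBox y * FBox z], fails at
    the root, so arbitrary models behave like finite chains; non-contractive algebras provide
    enough distinct powers.  The resulting matching problem simulates counter machines: [Y]
    is the history of symbols written to, and [Z] that of symbols read from, a queue holding
    the registers in unary, and the head symbol circulates in the queue.

    The rules depend only on the machine, and only the formula describing the worlds without
    successors depends on the input [n].  Given a decider [P], let [Q] on input [n] build
    the code of the instance whose machine-dependent part has code [n], run [P] on it, and
    halt iff [P] answers 1.  On the code of its own rules, [Q] halts iff it does not. *)

(** * Integral residuated lattices and valuations *)

Section Algebra.
Context (X : FLew).

Lemma le_refl (a : X) : le X a a.
Proof.
  unfold le. rewrite <- (join_absorb X a a) at 2. apply meet_absorb.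
Qed.

Lemma le_antisym (a b : X) : le X a b -> le X b a -> a = b.
Proof. unfold le. intros H1 H2. rewrite <- H1, meet_comm. exact H2. Qed.

Lemma le_trans (a b c : X) : le X a b -> le X b c -> le X a c.
Proof.
  unfold le. intros H1 H2. rewrite <- H1 at 1. rewrite <- meet_assoc, H2. exact H1.
Qed.

Lemma le_one (a : X) : le X a (one X).
Proof. apply one_top. Qed.

Lemma zero_le (a : X) : le X (zero X) a.
Proof. apply zero_bot. Qed.

Lemma one_le (a : X) : le X (one X) a -> a = one X.
Proof. intros H. apply le_antisym; [apply le_one | exact H]. Qed.

Lemma mul_one_l (a : X) : mul X (one X) a = a.
Proof. rewrite mul_comm. apply mul_one. Qed.

Lemma mul_le_l (a b c : X) : le X a b -> le X (mul X a c) (mul X b c).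
Proof.
  intros H. apply residuation. apply le_trans with b; [exact H|].
  apply residuation. apply le_refl.
Qed.

Lemma mul_le (a b c d : X) : le X a b -> le X c d -> le X (mul X a c) (mul X b d).
Proof.
  intros H1 H2. apply le_trans with (mul X b c).
  - apply mul_le_l, H1.
  - rewrite (mul_comm X b c), (mul_comm X b d). apply mul_le_l, H2.
Qed.

Lemma mul_le_left (a b : X) : le X (mul X a b) a.
Proof.
  rewrite <- (mul_one X a) at 2. apply mul_le; [apply le_refl | apply le_one].
Qed.

Lemma mul_le_right (a b : X) : le X (mul X a b) b.
Proof. rewrite mul_comm. apply mul_le_left. Qed.

Lemma imp_eq_one (a b : X) : imp X a b = one X <-> le X a b.
Proof.
  pose proof (residuation X (one X) a b) as H. rewrite mul_one_l in H.
  unfold le. rewrite H. split.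
  - intros ->. apply le_refl.
  - intros H'. apply one_le, H'.
Qed.

Lemma imp_one_l (a : X) : imp X (one X) a = a.
Proof.
  apply le_antisym.
  - rewrite <- (mul_one X (imp X (one X) a)). apply residuation, le_refl.
  - apply residuation. fold (le X (mul X a (one X)) a). rewrite mul_one. apply le_refl.
Qed.

Lemma meet_eq_one (a b : X) : meet X a b = one X <-> a = one X /\ b = one X.
Proof.
  split.
  - intros H. split; apply one_le; rewrite <- H; unfold le.
    + rewrite (meet_comm X a b), <- meet_assoc. f_equal. apply le_refl.
    + rewrite <- meet_assoc. f_equal. apply le_refl.
  - intros [-> ->]. apply le_refl.
Qed.

Lemma join_one_l (b : X) : join X (one X) b = one X.
Proof. apply one_le, meet_absorb. Qed.

Lemma join_one_r (a : X) : join X a (one X) = one X.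
Proof. rewrite join_comm. apply join_one_l. Qed.

Lemma join_le (a b : X) : le X a b -> join X a b = b.
Proof. unfold le. intros <-. rewrite join_comm, meet_comm. apply join_absorb. Qed.

Lemma join_eq_one (Hlin : linearly_ordered X) (a b : X) :
  join X a b = one X -> a = one X \/ b = one X.
Proof.
  intros H. destruct (Hlin a b) as [Hab|Hba].
  - right. now rewrite <- (join_le _ _ Hab).
  - left. now rewrite join_comm, (join_le _ _ Hba) in H.
Qed.

Lemma pw_add (a : X) m n : pw X a (m + n) = mul X (pw X a m) (pw X a n).
Proof.
  induction m as [|m IH]; simpl.
  - now rewrite mul_one_l.
  - now rewrite IH, mul_assoc.
Qed.

Lemma pw_mul (a : X) m n : pw X (pw X a m) n = pw X a (n * m).
Proof. induction n as [|n IH]; simpl; [reflexivity|]. now rewrite IH, pw_add. Qed.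

Lemma pw_anti (a : X) m n : m <= n -> le X (pw X a n) (pw X a m).
Proof.
  intros H. replace n with (m + (n - m)) by lia. rewrite pw_add. apply mul_le_left.
Qed.

Lemma pw_stable (a : X) m k : pw X a (S m) = pw X a m -> pw X a (m + k) = pw X a m.
Proof.
  intros H. induction k as [|k IH].
  - now rewrite Nat.add_0_r.
  - rewrite Nat.add_succ_r. simpl. rewrite IH. exact H.
Qed.

Lemma pw_eq_stable (a : X) m n : m < n -> pw X a n = pw X a m -> pw X a (S m) = pw X a m.
Proof.
  intros Hmn H. apply le_antisym.
  - apply pw_anti. lia.
  - rewrite <- H. apply pw_anti. lia.
Qed.

Lemma is_inf_unique (P Q : X -> Prop) a b :
  (forall c, P c <-> Q c) -> is_inf X P a -> is_inf X Q b -> a = b.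
Proof.
  intros E [H1 H2] [H3 H4]. apply le_antisym.
  - apply H4. intros c Hc. apply H1, E, Hc.
  - apply H2. intros c Hc. apply H3, E, Hc.
Qed.

Lemma is_sup_unique (P Q : X -> Prop) a b :
  (forall c, P c <-> Q c) -> is_sup X P a -> is_sup X Q b -> a = b.
Proof.
  intros E [H1 H2] [H3 H4]. apply le_antisym.
  - apply H2. intros c Hc. apply H3, E, Hc.
  - apply H4. intros c Hc. apply H1, E, Hc.
Qed.

Lemma meet_le_l (a b : X) : le X (meet X a b) a.
Proof.
  unfold le. rewrite (meet_comm X a b), <- meet_assoc. f_equal. apply le_refl.
Qed.

Lemma meet_le_r (a b : X) : le X (meet X a b) b.
Proof. rewrite meet_comm. apply meet_le_l. Qed.

Lemma le_meet (a b c : X) : le X c a -> le X c b -> le X c (meet X a b).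
Proof. unfold le. intros H1 H2. now rewrite meet_assoc, H1. Qed.

Lemma le_join_l (a b : X) : le X a (join X a b).
Proof. apply meet_absorb. Qed.

Lemma le_join_r (a b : X) : le X b (join X a b).
Proof. rewrite join_comm. apply le_join_l. Qed.

Lemma join_lub (a b c : X) : le X a c -> le X b c -> le X (join X a b) c.
Proof.
  intros H1 H2. unfold le.
  assert (E : join X (join X a b) c = c).
  { rewrite <- join_assoc, (join_le b c H2). apply join_le, H1. }
  rewrite <- E. apply meet_absorb.
Qed.

Context (W : Type).

Lemma finite_inf (f : W -> X) (P : W -> Prop) (l : list W) :
  exists a, is_inf X (fun b => exists w, (In w l /\ P w) /\ b = f w) a.
Proof.
  induction l as [|w l [a [H1 H2]]].
  - exists (one X). split.
    + now intros b (w & [[] _] & _).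
    + intros; apply le_one.
  - destruct (classic (P w)) as [HP|HP].
    + exists (meet X (f w) a). split.
      * intros b (w' & [[<-|Hw'] HP'] & ->); [apply meet_le_l|].
        eapply le_trans; [apply meet_le_r|]. apply H1. eauto.
      * intros c Hc. apply le_meet.
        -- apply Hc. exists w. simpl. auto.
        -- apply H2. intros b (w' & [Hw' HP'] & ->). apply Hc. exists w'. simpl. auto.
    + exists a. split.
      * intros b (w' & [[<-|Hw'] HP'] & ->); [now destruct HP|]. apply H1. eauto.
      * intros c Hc. apply H2. intros b (w' & [Hw' HP'] & ->).
        apply Hc. exists w'. simpl. auto.
Qed.

Lemma finite_sup (f : W -> X) (P : W -> Prop) (l : list W) :
  exists a, is_sup X (fun b => exists w, (In w l /\ P w) /\ b = f w) a.
Proof.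
  induction l as [|w l [a [H1 H2]]].
  - exists (zero X). split.
    + now intros b (w & [[] _] & _).
    + intros; apply zero_le.
  - destruct (classic (P w)) as [HP|HP].
    + exists (join X (f w) a). split.
      * intros b (w' & [[<-|Hw'] HP'] & ->); [apply le_join_l|].
        eapply le_trans; [|apply le_join_r]. apply H1. eauto.
      * intros c Hc. apply join_lub.
        -- apply Hc. exists w. simpl. auto.
        -- apply H2. intros b (w' & [Hw' HP'] & ->). apply Hc. exists w'. simpl. auto.
    + exists a. split.
      * intros b (w' & [[<-|Hw'] HP'] & ->); [now destruct HP|]. apply H1. eauto.
      * intros c Hc. apply H2. intros b (w' & [Hw' HP'] & ->).
        apply Hc. exists w'. simpl. auto.
Qed.

Context (R : W -> W -> Prop) (e : nat -> W -> X).

Lemma ev_unique f : forall v a b, ev X W R e f v a -> ev X W R e f v b -> a = b.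
Proof.
  induction f as [| | |f1 IH1 f2 IH2|f1 IH1 f2 IH2|f1 IH1 f2 IH2|f1 IH1 f2 IH2|f IH|f IH];
    simpl; intros v a b.
  1-3: congruence.
  1-4: intros (x & y & Hx & Hy & ->) (x' & y' & Hx' & Hy' & ->);
    now rewrite (IH1 _ _ _ Hx Hx'), (IH2 _ _ _ Hy Hy').
  - apply is_inf_unique. reflexivity.
  - apply is_sup_unique. reflexivity.
Qed.

(** Functional form of the relational semantics: every formula has a value, and [ev] is the graph of
    [val]. *)
Definition valuation (val : form -> W -> X) : Prop :=
  forall f v a, ev X W R e f v a <-> a = val f v.

Lemma safe_valuation : safe X W R e -> exists val, valuation val.
Proof.
  intros Hs.
  destruct (functional_choice
    (fun (p : form * W) a => ev X W R e (fst p) (snd p) a)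
    (fun p => Hs (fst p) (snd p))) as [g Hg].
  exists (fun f v => g (f, v)). intros f v a. split.
  - intros H. exact (ev_unique f v _ _ H (Hg (f, v))).
  - intros ->. exact (Hg (f, v)).
Qed.

(** A modality ranges over finitely many worlds, and a bounded lattice has all finite infima and
    suprema, so the finite countermodels are safe for free. *)
Lemma finite_safe : finite_type W -> safe X W R e.
Proof.
  intros [l Hl] f.
  induction f as [| | |f1 IH1 f2 IH2|f1 IH1 f2 IH2|f1 IH1 f2 IH2|f1 IH1 f2 IH2|f IH|f IH];
    simpl; intros v; eauto.
  1-4: destruct (IH1 v) as [a Ha], (IH2 v) as [b Hb]; eauto 6.
  all: destruct (functional_choice (fun w a => ev X W R e f w a) IH) as [g Hg].
  - destruct (finite_inf g (R v) l) as [a Ha]. exists a.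
    assert (E : forall b, (exists w, R v w /\ ev X W R e f w b) <->
                          (exists w, (In w l /\ R v w) /\ b = g w)).
    { intros b. split; intros (w & H1 & H2); exists w.
      - split; [auto|]. eapply ev_unique; eauto.
      - subst. split; [tauto | auto]. }
    destruct Ha as [H1 H2]. split.
    + intros b Hb. apply H1, E, Hb.
    + intros c Hc. apply H2. intros b Hb. apply Hc, E, Hb.
  - destruct (finite_sup g (R v) l) as [a Ha]. exists a.
    assert (E : forall b, (exists w, R v w /\ ev X W R e f w b) <->
                          (exists w, (In w l /\ R v w) /\ b = g w)).
    { intros b. split; intros (w & H1 & H2); exists w.
      - split; [auto|]. eapply ev_unique; eauto.
      - subst. split; [tauto | auto]. }
    destruct Ha as [H1 H2]. split.
    + intros b Hb. apply H1, E, Hb.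
    + intros c Hc. apply H2. intros b Hb. apply Hc, E, Hb.
Qed.

Context (val : form -> W -> X) (Hval : valuation val).

Lemma val_ev f v : ev X W R e f v (val f v).
Proof. now apply Hval. Qed.

Lemma val_var n v : val (Var n) v = e n v.
Proof. symmetry. now apply Hval. Qed.

Lemma val_zero v : val FZero v = zero X.
Proof. symmetry. now apply Hval. Qed.

Lemma val_one v : val FOne v = one X.
Proof. symmetry. now apply Hval. Qed.

Lemma val_and f g v : val (FAnd f g) v = meet X (val f v) (val g v).
Proof. symmetry. apply Hval. simpl. eauto 6 using val_ev. Qed.

Lemma val_or f g v : val (FOr f g) v = join X (val f v) (val g v).
Proof. symmetry. apply Hval. simpl. eauto 6 using val_ev. Qed.

Lemma val_prod f g v : val (FProd f g) v = mul X (val f v) (val g v).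
Proof. symmetry. apply Hval. simpl. eauto 6 using val_ev. Qed.

Lemma val_imp f g v : val (FImp f g) v = imp X (val f v) (val g v).
Proof. symmetry. apply Hval. simpl. eauto 6 using val_ev. Qed.

Lemma val_box_le f v w : R v w -> le X (val (FBox f) v) (val f w).
Proof.
  intros H. destruct (val_ev (FBox f) v) as [H1 _]. apply H1. exists w. split; [exact H | apply val_ev].
Qed.

Lemma val_box_glb f v c : (forall w, R v w -> le X c (val f w)) -> le X c (val (FBox f) v).
Proof.
  intros H. destruct (val_ev (FBox f) v) as [_ H2]. apply H2.
  intros b (w & Hw & Hb). apply Hval in Hb. subst. auto.
Qed.

Lemma val_dia_le f v w : R v w -> le X (val f w) (val (FDia f) v).
Proof.
  intros H. destruct (val_ev (FDia f) v) as [H1 _]. apply H1. exists w. split; [exact H | apply val_ev].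
Qed.

Lemma val_dia_lub f v c : (forall w, R v w -> le X (val f w) c) -> le X (val (FDia f) v) c.
Proof.
  intros H. destruct (val_ev (FDia f) v) as [_ H2]. apply H2.
  intros b (w & Hw & Hb). apply Hval in Hb. subst. auto.
Qed.

Lemma val_box_min f v w :
  R v w -> (forall u, R v u -> le X (val f w) (val f u)) -> val (FBox f) v = val f w.
Proof.
  intros Hw H. apply le_antisym.
  - now apply val_box_le.
  - now apply val_box_glb.
Qed.

Lemma val_box_one f v :
  val (FBox f) v = one X <-> forall w, R v w -> val f w = one X.
Proof.
  split.
  - intros H w Hw. apply one_le. rewrite <- H. now apply val_box_le.
  - intros H. apply one_le, val_box_glb. intros w Hw. rewrite (H w Hw). apply le_refl.
Qed.

Lemma val_imp_one f g v : val (FImp f g) v = one X <-> le X (val f v) (val g v).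
Proof. rewrite val_imp. apply imp_eq_one. Qed.

Lemma val_and_one f g v :
  val (FAnd f g) v = one X <-> val f v = one X /\ val g v = one X.
Proof. rewrite val_and. apply meet_eq_one. Qed.

Definition fiff f g := FAnd (FImp f g) (FImp g f).

Lemma val_iff_one f g v : val (fiff f g) v = one X <-> val f v = val g v.
Proof.
  unfold fiff. rewrite val_and_one, !val_imp_one. split.
  - intros [H1 H2]. now apply le_antisym.
  - intros ->. split; apply le_refl.
Qed.

Fixpoint fpow f n := match n with 0 => FOne | S n => FProd f (fpow f n) end.

Lemma val_pow f n v : val (fpow f n) v = pw X (val f v) n.
Proof.
  induction n as [|n IH]; simpl.
  - apply val_one.
  - now rewrite val_prod, IH.
Qed.

End Algebra.

(** * Matching problems as modal formulas *)

(** Bijective base 2, with [false] as digit 1 and [true] as digit 2; the word is appended to the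
    numeral of [N]. *)
Definition push (w : list bool) (N : nat) : nat :=
  fold_left (fun N (b : bool) => 2 * N + if b then 2 else 1) w N.

(** Appending a fixed word is an affine map, which a formula can perform on exponents by one power
    and one factor that is a power of [fx]. *)
Lemma push_affine w : forall N, push w N = 2 ^ length w * N + push w 0.
Proof.
  unfold push. induction w as [|b w IH]; intros N; cbn [fold_left length].
  - simpl. lia.
  - rewrite IH, (IH (2 * 0 + _)), Nat.pow_succ_r'. nia.
Qed.

Lemma push_le w N : N <= push w N.
Proof.
  rewrite push_affine. pose proof (Nat.pow_nonzero 2 (length w)). nia.
Qed.

Lemma push_pos w N : w <> [] -> 0 < push w N.
Proof.
  destruct w as [|b w]; [easy|]. intros _.
  change (0 < push w (2 * N + if b then 2 else 1)).
  eapply Nat.lt_le_trans; [|apply push_le]. destruct b; lia.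
Qed.

Definition tile : Type := (list bool * list bool)%type.

(** [Y] receives the second components of the tiles and [Z] the first; a match is a reachable pair
    with [Y = Z]. *)
Inductive reach (T : list tile) (N0 : nat) : nat -> nat -> Prop :=
| reach_start : reach T N0 N0 0
| reach_tile Y Z u v :
    reach T N0 Y Z -> In (u, v) T -> reach T N0 (push v Y) (push u Z).

Notation fx := (Var 0).
Notation fy := (Var 1).
Notation fz := (Var 2).

(* If all successors carry powers of x, this says that the infima of y and of z
   are attained at one and the same successor. *)
Definition joint_form : form :=
  fiff (FBox (FProd fy fz)) (FProd (FBox fy) (FBox fz)).

Definition push_form (w : list bool) (f : form) : form :=
  FProd (fpow f (2 ^ length w)) (fpow fx (push w 0)).

Definition tile_form (t : tile) : form :=
  FAnd (fiff fz (push_form (fst t) (FBox fz))) (fiff fy (push_form (snd t) (FBox fy))).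

(** Either a dead end, where [z] has exponent 0, or a world with a successor, at which one tile is
    applied to the jointly attained infima of [y] and [z]. *)
Definition world_form (T : list tile) : form :=
  FOr (FAnd (FBox FZero) fz)
    (FAnd (FDia FOne) (FAnd joint_form (fold_right FOr FZero (map tile_form T)))).

Definition game_forms (T : list tile) : list form :=
  [FAnd (FImp fx (FBox fx)) (FImp (FDia fx) fx);
   FBox (world_form T); FDia FOne; joint_form; fiff (FBox fy) (FBox fz)].

(** [FBox FZero] has value one at dead ends, so there [y] takes the value of [u]; the input enters
    the instance only through [u]. *)
Definition start_form (u : form) : form :=
  FBox (FImp (FBox FZero) (FAnd (FImp fy u) (FImp u fy))).

Definition goal_form : form :=
  FImp (FProd (FBox fy) (FBox fz)) (FProd fx (FProd (FBox fy) (FBox fz))).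

Definition denotes_power (u : form) (N : nat) : Prop :=
  forall X W R e val, valuation X W R e val ->
  forall w, val u w = pw X (val fx w) N.

Lemma bounded_max (P : nat -> Prop) n :
  (exists m, P m) -> (forall m, P m -> m < n) ->
  exists m, P m /\ forall k, P k -> k <= m.
Proof.
  induction n as [|n IH]; intros [m Hm] Hb.
  - specialize (Hb m Hm). lia.
  - destruct (classic (P n)) as [Hn|Hn].
    + exists n. split; [exact Hn|]. intros k Hk. specialize (Hb k Hk). lia.
    + apply IH; [eauto|]. intros k Hk. specialize (Hb k Hk).
      assert (k <> n) by congruence. lia.
Qed.

(** In a chain, one is join-prime, so some disjunct has value one; the empty disjunction [FZero]
    accounts for the degenerate case. *)
Lemma val_or_list X W R e val (Hval : valuation X W R e val) (Hlin : linearly_ordered X)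
  (l : list form) w :
  val (fold_right FOr FZero l) w = one X ->
  one X = zero X \/ exists f, In f l /\ val f w = one X.
Proof.
  induction l as [|f l IH]; simpl.
  - rewrite (val_zero X W R e val Hval). auto.
  - rewrite (val_or X W R e val Hval). intros H.
    apply join_eq_one in H; [|exact Hlin]. destruct H as [H|H]; [eauto|].
    destruct (IH H) as [H0|(g & Hg & Hg1)]; eauto.
Qed.

Lemma val_or_list_in X W R e val (Hval : valuation X W R e val) (l : list form) f w :
  In f l -> val f w = one X -> val (fold_right FOr FZero l) w = one X.
Proof.
  intros Hf H. induction l as [|g l IH]; simpl in *; [easy|].
  rewrite (val_or X W R e val Hval). destruct Hf as [->|Hf].
  - rewrite H. apply join_one_l.
  - rewrite (IH Hf). apply join_one_r.
Qed.

Lemma val_push X W R e val (Hval : valuation X W R e val) t f w N :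
  val f w = pw X (val fx w) N ->
  val (push_form t f) w = pw X (val fx w) (push t N).
Proof.
  intros H. unfold push_form.
  rewrite (val_prod X W R e val Hval), !(val_pow X W R e val Hval), H, pw_mul.
  rewrite <- pw_add. f_equal. now rewrite <- push_affine.
Qed.

(** * A model refuting the goal yields a match *)

Section Soundness.
Context (X : FLew) (Hwa : weakly_archimedean X) (Hlin : linearly_ordered X).
Context (W : Type) (R : W -> W -> Prop) (e : nat -> W -> X) (val : form -> W -> X).
Context (Hval : valuation X W R e val) (Htr : transitive_rel W R).
Context (T : list tile) (Hne : forall u v, In (u, v) T -> u <> []).
Context (N0 : nat) (u0 : form) (Hu0 : denotes_power u0 N0).
Context (v : W).
Context (Hgame : forall g, In g (start_form u0 :: game_forms T) -> val g v = one X).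
Context (Hgoal : val goal_form v <> one X).

Let a : X := val fx v.
Let s : X := val (FProd (FBox fy) (FBox fz)) v.

Lemma root_not_contractive : ~ le X s (mul X a s).
Proof.
  intros H. apply Hgoal. unfold goal_form.
  rewrite (val_imp_one X W R e val Hval), (val_prod X W R e val Hval fx). exact H.
Qed.

(** Weak archimedeanity enters here: were [s] below all powers of [a], then [mul X s a = s] and the
    goal formula would hold at the root. *)
Lemma root_not_below_powers : exists n, ~ le X s (pw X a n).
Proof.
  apply not_all_ex_not. intros H. apply root_not_contractive.
  rewrite mul_comm, (Hwa s a H). apply le_refl.
Qed.

Lemma algebra_nontrivial : one X <> zero X.
Proof.
  intros H. apply root_not_contractive.
  apply le_trans with (one X); [apply le_one|]. rewrite H. apply zero_le.
Qed.

Lemma x_constant w : R v w -> val fx w = a.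
Proof.
  intros Hw. assert (H := Hgame _ (or_intror (or_introl eq_refl))).
  apply (val_and_one X W R e val Hval) in H. destruct H as [H1 H2].
  apply (val_imp_one X W R e val Hval) in H1, H2.
  apply le_antisym.
  - eapply le_trans; [|exact H2]. now apply (val_dia_le X W R e val Hval).
  - eapply le_trans; [exact H1|]. now apply (val_box_le X W R e val Hval).
Qed.

Lemma root_below_y w : R v w -> le X s (val fy w).
Proof.
  intros Hw. unfold s. rewrite (val_prod X W R e val Hval).
  eapply le_trans; [apply mul_le_left|]. now apply (val_box_le X W R e val Hval).
Qed.

Lemma root_below_z w : R v w -> le X s (val fz w).
Proof.
  intros Hw. unfold s. rewrite (val_prod X W R e val Hval).
  eapply le_trans; [apply mul_le_right|]. now apply (val_box_le X W R e val Hval).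
Qed.

Lemma root_below_yz w : R v w -> le X s (val (FProd fy fz) w).
Proof.
  intros Hw. unfold s. rewrite !(val_prod X W R e val Hval).
  apply mul_le; now apply (val_box_le X W R e val Hval).
Qed.

Lemma power_bounded n m : ~ le X s (pw X a n) -> le X s (pw X a m) -> m < n.
Proof.
  intros Hn Hm. destruct (Nat.lt_ge_cases m n) as [|H]; [assumption|].
  destruct Hn. eapply le_trans; [exact Hm|]. now apply pw_anti.
Qed.

(** Two equal powers make the sequence constant from the smaller exponent on; if their common value
    lies above [s], then all powers do, against [root_not_below_powers]. *)
Lemma power_injective m k : le X s (pw X a m) -> pw X a m = pw X a k -> m = k.
Proof.
  intros Hm E. destruct root_not_below_powers as [n Hn].
  assert (Hlt : forall i j, i < j -> le X s (pw X a i) -> pw X a j <> pw X a i).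
  { intros i j Hij Hi H. apply pw_eq_stable in H; [|exact Hij].
    apply Hn. rewrite <- (pw_stable X a i n H) in Hi.
    eapply le_trans; [exact Hi|]. apply pw_anti. lia. }
  destruct (Nat.lt_trichotomy m k) as [H|[H|H]]; [|exact H|].
  - now destruct (Hlt _ _ H Hm).
  - destruct (Hlt _ _ H); [|exact E]. now rewrite <- E.
Qed.

(** Exponents of powers above [s] are bounded, so a largest one occurs among the successors and
    gives the least value; the infimum is a minimum. *)
Lemma box_attained f w :
  (exists w', R w w') ->
  (forall w', R w w' -> le X s (val f w') /\ exists m, val f w' = pw X a m) ->
  exists w' M, R w w' /\ val f w' = pw X a M /\ val (FBox f) w = pw X a M /\
    forall w'' m, R w w'' -> val f w'' = pw X a m -> m <= M.
Proof.
  intros [w1 Hw1] H. destruct root_not_below_powers as [n Hn].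
  destruct (bounded_max (fun m => exists w', R w w' /\ val f w' = pw X a m) n)
    as (M & (w' & Hw' & HM) & Hmax).
  - destruct (H w1 Hw1) as [_ [m Hm]]. eauto.
  - intros m (w' & Hw' & Hm). apply (power_bounded n m Hn).
    rewrite <- Hm. now apply H.
  - exists w', M. repeat split; eauto.
    rewrite <- HM. apply (val_box_min X W R e val Hval); [exact Hw'|].
    intros u Hu. destruct (H u Hu) as [_ [m Hm]]. rewrite HM, Hm.
    apply pw_anti, Hmax. eauto.
Qed.

Definition reached (w : W) : Prop :=
  exists Y Z, reach T N0 Y Z /\ val fy w = pw X a Y /\ val fz w = pw X a Z.

Lemma dia_one_successor w : val (FDia FOne) w = one X -> exists w', R w w'.
Proof.
  intros H. apply NNPP. intros Hno. apply algebra_nontrivial.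
  symmetry. apply one_le. rewrite <- H.
  apply (val_dia_lub X W R e val Hval). intros w' Hw'. destruct Hno. eauto.
Qed.

(** Let [My] and [Mz] be the largest exponents of [y] and [z], and let the product be least at [w']
    with exponents [Y] and [Z]. The joint formula gives [My + Mz = Y + Z], while [Y <= My] and
    [Z <= Mz], so both infima are attained at [w']. *)
Lemma joint_successor w :
  (forall w', R w w' -> R v w' /\ reached w') ->
  val (FDia FOne) w = one X -> val joint_form w = one X ->
  exists Y Z, reach T N0 Y Z /\
    val (FBox fy) w = pw X a Y /\ val (FBox fz) w = pw X a Z /\
    exists w', R w w' /\ val fy w' = pw X a Y /\ val fz w' = pw X a Z.
Proof.
  intros Hs Hd Hj. apply dia_one_successor in Hd.
  apply (val_iff_one X W R e val Hval) in Hj. rewrite (val_prod X W R e val Hval) in Hj.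
  destruct (box_attained fy w Hd) as (_ & My & _ & _ & Ey & Hy).
  { intros w' Hw'. destruct (Hs w' Hw') as (Hv & Y & Z & _ & H & _).
    split; [now apply root_below_y | eauto]. }
  destruct (box_attained fz w Hd) as (_ & Mz & _ & _ & Ez & Hz).
  { intros w' Hw'. destruct (Hs w' Hw') as (Hv & Y & Z & _ & _ & H).
    split; [now apply root_below_z | eauto]. }
  destruct (box_attained (FProd fy fz) w Hd) as (w' & M & Hw' & EM & E & _).
  { intros w' Hw'. destruct (Hs w' Hw') as (Hv & Y & Z & _ & H1 & H2).
    split; [now apply root_below_yz|]. exists (Y + Z).
    now rewrite (val_prod X W R e val Hval), H1, H2, pw_add. }
  destruct (Hs w' Hw') as (Hv & Y & Z & Hr & H1 & H2).
  assert (HsM : le X s (pw X a M)) by (rewrite <- EM; now apply root_below_yz).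
  rewrite E, Ey, Ez, <- pw_add in Hj.
  assert (E1 : M = My + Mz) by now apply power_injective.
  rewrite (val_prod X W R e val Hval), H1, H2, <- pw_add in EM.
  assert (E2 : M = Y + Z) by (apply power_injective; [exact HsM | now symmetry]).
  specialize (Hy _ _ Hw' H1). specialize (Hz _ _ Hw' H2).
  assert (My = Y) by lia. assert (Mz = Z) by lia. subst My Mz.
  exists Y, Z. eauto 8.
Qed.

(** Induction on [k] stands in for well-foundedness of [R]: every tile reads a nonempty word, so if
    [z] at [w] is not below the power [S k] of [a], then [z] at each successor is not below the
    power [k]. *)
Lemma all_reached_upto k : forall w, R v w -> ~ le X (val fz w) (pw X a k) -> reached w.
Proof.
  induction k as [|k IH]; intros w Hw Hk.
  - destruct Hk. apply le_one.
  - assert (Hstart := Hgame _ (or_introl eq_refl)).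
    assert (Hworld := Hgame _ (or_intror (or_intror (or_introl eq_refl)))).
    apply (proj1 (val_box_one X W R e val Hval _ _)) with (w := w) in Hworld, Hstart;
      [|exact Hw..].
    unfold world_form in Hworld. rewrite (val_or X W R e val Hval) in Hworld.
    apply join_eq_one in Hworld; [|exact Hlin]. destruct Hworld as [H|H].
    + apply (val_and_one X W R e val Hval) in H. destruct H as [H0 Hz].
      rewrite (val_imp X W R e val Hval), H0, imp_one_l in Hstart.
      apply (val_iff_one X W R e val Hval) in Hstart.
      rewrite (Hu0 _ _ _ _ _ Hval), x_constant in Hstart by exact Hw.
      exists N0, 0. repeat split; [constructor | exact Hstart | exact Hz].
    + apply (val_and_one X W R e val Hval) in H. destruct H as [Hd H].
      apply (val_and_one X W R e val Hval) in H. destruct H as [Hj H].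
      apply (val_or_list X W R e val Hval Hlin) in H.
      destruct H as [H|(f & Hf & H)]; [now destruct algebra_nontrivial|].
      apply in_map_iff in Hf. destruct Hf as ([tu tv] & <- & Ht).
      apply (val_and_one X W R e val Hval) in H. destruct H as [Hz Hy].
      apply (val_iff_one X W R e val Hval) in Hz, Hy. cbn [fst snd] in Hz, Hy.
      (* [push tu 0] and [2 ^ length tu] are both at least 1, so each factor of the pushed formula
         can be weakened to a first power. *)
      assert (Hzle : le X (val fz w) (mul X a (val (FBox fz) w))).
      { rewrite Hz. unfold push_form. rewrite (val_prod X W R e val Hval).
        rewrite !(val_pow X W R e val Hval), x_constant by exact Hw.
        rewrite (mul_comm X a). pose proof (push_pos tu 0 (Hne tu tv Ht)).
        pose proof (Nat.pow_nonzero 2 (length tu)).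
        apply mul_le.
        - rewrite <- (mul_one X (val (FBox fz) w)) at 2.
          apply (pw_anti X _ 1). lia.
        - rewrite <- (mul_one X a) at 2. apply (pw_anti X _ 1). lia. }
      destruct (joint_successor w) as (Y & Z & Hr & Ey & Ez & _);
        [|assumption|assumption|].
      { intros w' Hw'. assert (Hv : R v w') by (eapply Htr; eauto).
        split; [exact Hv|]. apply IH; [exact Hv|]. intros Hle. apply Hk.
        eapply le_trans; [exact Hzle|]. apply mul_le; [apply le_refl|].
        eapply le_trans; [|exact Hle]. now apply (val_box_le X W R e val Hval). }
      rewrite <- (x_constant w Hw) in Ey, Ez.
      rewrite (val_push X W R e val Hval _ _ _ _ Ey), x_constant in Hy by exact Hw.
      rewrite (val_push X W R e val Hval _ _ _ _ Ez), x_constant in Hz by exact Hw.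
      exists (push tv Y), (push tu Z). repeat split; [|exact Hy|exact Hz].
      now constructor.
Qed.

(** [s] lies below [z] at every successor of the root, so a single exponent [n] serves for all of
    them in [all_reached_upto]. *)
Lemma model_reach : exists N, reach T N0 N N.
Proof.
  destruct root_not_below_powers as [n Hn].
  destruct (joint_successor v) as (Y & Z & Hr & Ey & Ez & w & Hw & HY & HZ).
  - intros w Hw. split; [exact Hw|]. apply (all_reached_upto n); [exact Hw|].
    intros H. apply Hn. eapply le_trans; [exact (root_below_z w Hw) | exact H].
  - apply Hgame. simpl. auto 10.
  - apply Hgame. simpl. auto 10.
  - assert (Heq : val (fiff (FBox fy) (FBox fz)) v = one X)
      by (apply Hgame; simpl; auto 10).
    apply (val_iff_one X W R e val Hval) in Heq.
    assert (Y = Z).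
    { apply power_injective; [|congruence]. rewrite <- HY. now apply root_below_y. }
    subst Z. eauto.
Qed.

End Soundness.

Lemma game_sound (A : FLew -> Prop) (T : list tile) (N0 : nat) (u0 : form) :
  (forall X, A X -> weakly_archimedean X /\ linearly_ordered X) ->
  (forall u v, In (u, v) T -> u <> []) -> denotes_power u0 N0 ->
  ~ (exists N, reach T N0 N N) ->
  cons_4K A (start_form u0 :: game_forms T) goal_form.
Proof.
  intros HA Hne Hu0 Hno X W R e HX _ Hsafe Htr v Hg.
  destruct (HA X HX) as [Hwa Hlin].
  destruct (safe_valuation X W R e Hsafe) as [val Hval].
  apply Hval. symmetry. apply NNPP. intros Hgoal. apply Hno.
  apply (model_reach X Hwa Hlin W R e val Hval Htr T Hne N0 u0 Hu0 v); [|exact Hgoal].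
  intros g Hin. symmetry. now apply Hval, Hg.
Qed.

(** * A match yields a finite chain refuting the goal *)

Lemma reach_sequence T N0 Y Z : reach T N0 Y Z ->
  exists k f, f 0 = (N0, 0) /\ f k = (Y, Z) /\
    forall i, i < k -> exists u v, In (u, v) T /\
      f (S i) = (push v (fst (f i)), push u (snd (f i))).
Proof.
  induction 1 as [|Y Z u v _ (k & f & H0 & Hk & Hs) Hin].
  - exists 0, (fun _ => (N0, 0)). repeat split. lia.
  - exists (S k), (fun i => if i <=? k then f i else (push v Y, push u Z)).
    split; [exact H0|]. split.
    + now rewrite (proj2 (Nat.leb_gt (S k) k) (Nat.lt_succ_diag_r k)).
    + intros i Hi. rewrite (proj2 (Nat.leb_le i k)) by lia.
      destruct (Nat.leb_spec (S i) k).
      * apply Hs. lia.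
      * assert (i = k) by lia. subst i. rewrite Hk. eauto.
Qed.

(** The bound is a boolean equation, whose proofs are unique, so worlds with the same number are
    equal. *)
Definition level (m : nat) : Type := {i : nat | (i <? m) = true}.

Lemma level_exists m i : i < m -> exists w : level m, proj1_sig w = i.
Proof. intros H. apply Nat.ltb_lt in H. now exists (exist _ i H). Qed.

Lemma level_eq m (w w' : level m) : proj1_sig w = proj1_sig w' -> w = w'.
Proof.
  destruct w as [i Hi], w' as [j Hj]. simpl. intros <-. f_equal.
  apply Eqdep_dec.UIP_dec, Bool.bool_dec.
Qed.

Lemma level_finite m : finite_type (level m).
Proof.
  enough (H : forall k, exists l : list (level m), forall w, proj1_sig w < k -> In w l).
  { destruct (H m) as [l Hl]. exists l. intros w. apply Hl.
    apply Nat.ltb_lt. exact (proj2_sig w). }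
  induction k as [|k [l Hl]].
  - exists []. lia.
  - destruct (classic (exists w : level m, proj1_sig w = k)) as [[w0 Hw0]|Hno].
    + exists (w0 :: l). intros w Hw. destruct (Nat.eq_dec (proj1_sig w) k) as [E|E].
      * left. apply level_eq. congruence.
      * right. apply Hl. lia.
    + exists l. intros w Hw. apply Hl.
      assert (proj1_sig w <> k) by (intros E; apply Hno; eauto). lia.
Qed.

Section ChainModel.
Context (X : FLew) (a : X) (T : list tile) (N0 : nat) (u0 : form).
Context (Hu0 : denotes_power u0 N0).
Context (k : nat) (f : nat -> nat * nat).
Context (Hf0 : f 0 = (N0, 0)).
Context (Hfs : forall i, i < k -> exists u v, In (u, v) T /\
  f (S i) = (push v (fst (f i)), push u (snd (f i)))).
Context (N : nat) (Hfk : f k = (N, N)) (HN : pw X a (S (N + N)) <> pw X a (N + N)).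

Let W : Type := level (S (S k)).
(** World 0 is the dead end and world [S k] the root; each world sees all those with smaller
    numbers. *)
Definition chain_rel (w w' : W) : Prop := proj1_sig w' < proj1_sig w.
Definition chain_val (n : nat) (w : W) : X :=
  match n with
  | 0 => a
  | 1 => pw X a (fst (f (proj1_sig w)))
  | 2 => pw X a (snd (f (proj1_sig w)))
  | _ => one X
  end.
Context (val : form -> W -> X) (Hval : valuation X W chain_rel chain_val val).

Lemma chain_monotone i j : i <= j -> j <= k ->
  fst (f i) <= fst (f j) /\ snd (f i) <= snd (f j).
Proof.
  intros Hij Hj. induction j as [|j IH].
  - assert (i = 0) by lia. subst. auto.
  - destruct (Nat.eq_dec i (S j)) as [->|]; [auto|].
    destruct IH as [H1 H2]; try lia.
    destruct (Hfs j) as (u & v & _ & ->); [lia|]. cbn [fst snd].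
    pose proof (push_le v (fst (f j))). pose proof (push_le u (snd (f j))). lia.
Qed.

(** Exponents grow with the number of the world, so among the successors of world [S i] the world
    [i] has the least [y], the least [z] and the least product at once. *)
Lemma chain_box i (w : W) : i <= k -> proj1_sig w = S i ->
  val (FBox fy) w = pw X a (fst (f i)) /\ val (FBox fz) w = pw X a (snd (f i)) /\
  val (FBox (FProd fy fz)) w = pw X a (fst (f i) + snd (f i)).
Proof.
  intros Hi Hw. destruct (level_exists (S (S k)) i) as [w' Hw']; [lia|].
  assert (HR : chain_rel w w') by (unfold chain_rel; lia).
  assert (Hm : forall u : W, chain_rel w u ->
    fst (f (proj1_sig u)) <= fst (f i) /\ snd (f (proj1_sig u)) <= snd (f i)).
  { intros u Hu. apply chain_monotone; unfold chain_rel in Hu; lia. }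
  rewrite pw_add. rewrite !(fun g H => val_box_min X W chain_rel chain_val val Hval g w w' HR H).
  - rewrite (val_prod X W _ _ val Hval), !(val_var X W _ _ val Hval). simpl.
    rewrite Hw'. auto.
  - intros u Hu. rewrite !(val_prod X W _ _ val Hval), !(val_var X W _ _ val Hval). simpl.
    rewrite Hw'. apply mul_le; apply pw_anti, Hm, Hu.
  - intros u Hu. rewrite !(val_var X W _ _ val Hval). simpl.
    rewrite Hw'. apply pw_anti, Hm, Hu.
  - intros u Hu. rewrite !(val_var X W _ _ val Hval). simpl.
    rewrite Hw'. apply pw_anti, Hm, Hu.
Qed.

Lemma chain_joint i (w : W) : i <= k -> proj1_sig w = S i -> val joint_form w = one X.
Proof.
  intros Hi Hw. destruct (chain_box i w Hi Hw) as (H1 & H2 & H3).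
  apply (val_iff_one X W _ _ val Hval).
  now rewrite H3, (val_prod X W _ _ val Hval), H1, H2, pw_add.
Qed.

Lemma chain_dia_one i (w : W) : proj1_sig w = S i -> val (FDia FOne) w = one X.
Proof.
  intros Hw. destruct (level_exists (S (S k)) 0) as [w' Hw']; [lia|].
  apply one_le. rewrite <- (val_one X W _ _ val Hval w').
  apply (val_dia_le X W _ _ val Hval). unfold chain_rel. lia.
Qed.

Lemma chain_world (w : W) : proj1_sig w <= k -> val (world_form T) w = one X.
Proof.
  intros Hw. unfold world_form. rewrite (val_or X W _ _ val Hval).
  destruct (proj1_sig w) as [|i] eqn:E.
  - rewrite (proj2 (val_and_one X W _ _ val Hval _ _ w)); [apply join_one_l|]. split.
    + apply (val_box_one X W _ _ val Hval). intros w' Hw'. unfold chain_rel in Hw'. lia.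
    + rewrite (val_var X W _ _ val Hval). simpl. rewrite E, Hf0. reflexivity.
  - rewrite (proj2 (val_and_one X W _ _ val Hval (FDia FOne) _ w)); [apply join_one_r|].
    split; [now apply chain_dia_one with i|].
    apply (val_and_one X W _ _ val Hval). split; [apply chain_joint with i; [lia | exact E]|].
    destruct (Hfs i) as (u & v & Hin & Hi); [lia|].
    destruct (chain_box i w) as (H1 & H2 & _); [lia | exact E |].
    assert (Hx : val fx w = a) by now rewrite (val_var X W _ _ val Hval).
    apply (val_or_list_in X W _ _ val Hval _ (tile_form (u, v))); [now apply in_map|].
    apply (val_and_one X W _ _ val Hval); split; apply (val_iff_one X W _ _ val Hval);
      rewrite (val_var X W _ _ val Hval); cbn [chain_val fst snd]; rewrite E, Hi; cbn [fst snd];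
      symmetry; rewrite <- Hx; apply (val_push X W _ _ val Hval); now rewrite Hx.
Qed.

Lemma chain_start (w : W) : val (FImp (FBox FZero) (FAnd (FImp fy u0) (FImp u0 fy))) w = one X.
Proof.
  apply (val_imp_one X W _ _ val Hval).
  destruct (proj1_sig w) as [|i] eqn:E.
  - fold (fiff fy u0). rewrite (proj2 (val_iff_one X W _ _ val Hval fy u0 w)); [apply le_one|].
    rewrite (Hu0 _ _ _ _ _ Hval), !(val_var X W _ _ val Hval). simpl. now rewrite E, Hf0.
  - destruct (level_exists (S (S k)) 0) as [w' Hw']; [lia|].
    eapply le_trans; [|apply zero_le].
    rewrite <- (val_zero X W _ _ val Hval w'). apply (val_box_le X W _ _ val Hval).
    unfold chain_rel. lia.
Qed.

Lemma chain_refutes (w : W) : proj1_sig w = S k ->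
  (forall g, In g (start_form u0 :: game_forms T) -> val g w = one X) /\
  val goal_form w <> one X.
Proof.
  intros Hw. destruct (chain_box k w (le_n k) Hw) as (H1 & H2 & _).
  rewrite Hfk in H1, H2. cbn [fst snd] in H1, H2.
  assert (Hx : forall u, val fx u = a) by (intros; now rewrite (val_var X W _ _ val Hval)).
  split.
  - intros g [<-|[<-|[<-|[<-|[<-|[<-|[]]]]]]].
    + apply (val_box_one X W _ _ val Hval). intros; apply chain_start.
    + apply (val_and_one X W _ _ val Hval).
      split; apply (val_imp_one X W _ _ val Hval); rewrite Hx.
      * apply (val_box_glb X W _ _ val Hval). intros; rewrite Hx. apply le_refl.
      * apply (val_dia_lub X W _ _ val Hval). intros; rewrite Hx. apply le_refl.
    + apply (val_box_one X W _ _ val Hval). intros w' Hw'. apply chain_world.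
      unfold chain_rel in Hw'. lia.
    + now apply chain_dia_one with k.
    + now apply chain_joint with k.
    + apply (val_iff_one X W _ _ val Hval). congruence.
  (* The goal would put the power [N + N] of [a] below its power [S (N + N)], against [HN]. *)
  - intros H. apply (val_imp_one X W _ _ val Hval) in H.
    rewrite !(val_prod X W _ _ val Hval), H1, H2, Hx, <- pw_add in H.
    apply HN, le_antisym; [apply (pw_anti X a (N + N)); lia | exact H].
Qed.

End ChainModel.

Lemma game_complete (A : FLew -> Prop) (T : list tile) (N0 : nat) (u0 : form) (N : nat) :
  (forall n : nat, exists X, A X /\ exists a : X, pw X a (S n) <> pw X a n) ->
  denotes_power u0 N0 -> reach T N0 N N ->
  ~ cons_w4K A (start_form u0 :: game_forms T) goal_form.
Proof.
  intros HA Hu0 Hr Hc. destruct (reach_sequence _ _ _ _ Hr) as (k & f & H0 & Hk & Hs).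
  (* At the root the product of the two boxes will be the power [N + N], which must differ from the
     next one. *)
  destruct (HA (N + N)) as (X & HX & a & Ha).
  pose proof (level_finite (S (S k))) as Hfin.
  pose proof (finite_safe X _ (chain_rel k) (chain_val X a k f) Hfin) as Hsafe.
  destruct (safe_valuation X _ _ _ Hsafe) as [val Hval].
  destruct (level_exists (S (S k)) (S k)) as [w Hw]; [lia|].
  destruct (chain_refutes X a T N0 u0 Hu0 k f H0 Hs N Hk Ha val Hval w Hw) as [Hg Hgoal].
  apply Hgoal. symmetry. apply Hval.
  apply (Hc X _ (chain_rel k) (chain_val X a k f)); try assumption.
  - now constructor.
  - intros u1 u2 u3 H1 H2. unfold chain_rel in *. lia.
  - intros g Hin. apply Hval. symmetry. auto.
Qed.

(** Each round sends the exponent [N] to [2 * N + 1], that is, appends the digit [false]. As one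
    fixed operation is iterated, a loop can compute the code of the formula. *)
Fixpoint num_form (c n : nat) : form :=
  match n with 0 => fpow fx c | S n => FProd (FProd (num_form c n) (num_form c n)) fx end.

Lemma num_form_denotes c n : denotes_power (num_form c n) (push (repeat false n) c).
Proof.
  intros X W R e val Hval w.
  replace (repeat false n) with (rev (repeat false n)) by apply rev_repeat.
  induction n as [|n IH]; simpl.
  - apply (val_pow X W R e val Hval).
  - rewrite !(val_prod X W R e val Hval), IH. unfold push. rewrite fold_left_app. simpl.
    now rewrite <- pw_add, Nat.add_0_r, Nat.add_1_r, mul_comm.
Qed.

Lemma game_three_vars T c n :
  three_var_inputs (start_form (num_form c n) :: game_forms T) goal_form.
Proof.
  assert (Hpow : forall f m, vars_below 3 f -> vars_below 3 (fpow f m))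
    by (intros f m Hf; induction m; simpl; auto).
  assert (Hnum : vars_below 3 (num_form c n)).
  { induction n; simpl; [apply Hpow; simpl; lia | repeat split; auto; lia]. }
  assert (Htiles : vars_below 3 (fold_right FOr FZero (map tile_form T))).
  { induction T as [|t T' IH]; simpl; [auto|].
    repeat split; auto; try apply Hpow; simpl; lia. }
  split; [|simpl; lia].
  intros g [<-|[<-|[<-|[<-|[<-|[<-|[]]]]]]]; simpl; repeat split; auto; lia.
Qed.

(** * Counter machines as matching problems *)

Lemma push_app w1 w2 N : push (w1 ++ w2) N = push w2 (push w1 N).
Proof. apply fold_left_app. Qed.

(** Parity determines the last digit, and a nonempty word has a positive number. *)
Lemma push_injective w1 : forall w2, push w1 0 = push w2 0 -> w1 = w2.
Proof.
  induction w1 as [|b1 w1 IH] using rev_ind; intros w2;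
    destruct w2 as [|b2 w2 _] using rev_ind; intros H.
  - reflexivity.
  - rewrite push_app in H. pose proof (push_pos [b2] (push w2 0)). simpl in *.
    assert (0 < 0); [|lia]. rewrite H at 2. now apply H0.
  - rewrite push_app in H. pose proof (push_pos [b1] (push w1 0)). simpl in *.
    assert (0 < 0); [|lia]. rewrite <- H at 2. now apply H0.
  - rewrite !push_app in H. cbn [push fold_left] in H. fold (push w1 0) (push w2 0) in H.
    assert (b1 = b2) by (destruct b1, b2; auto; lia). subst b2.
    rewrite (IH w2); [reflexivity | destruct b1; lia].
Qed.

(* The head letters [LBusy q i] and [LMove q i] carry the machine's control state:
   instruction [q] is still to be executed, resp. is the next one, and the head stands
   in block [i - 1] of the circular tape (registers in decreasing order, register [r]
   being [LOne] repeated and closed by [LHash]). *)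
Inductive letter : Type :=
| LOne | LStart | LHash | LHalt
| LBusy : nat -> nat -> letter
| LMove : nat -> nat -> letter.

(** [LOne] has index 0, so its code is the single digit [false], and [n] ones are exactly what
    [num_form] appends. Parity separates the two kinds of head letters. *)
Definition letter_index (a : letter) : nat :=
  match a with
  | LOne => 0 | LStart => 1 | LHash => 2 | LHalt => 3
  | LBusy q i => 4 + 2 * Cantor.to_nat (q, i)
  | LMove q i => 5 + 2 * Cantor.to_nat (q, i)
  end.

Lemma letter_index_injective a b : letter_index a = letter_index b -> a = b.
Proof.
  destruct a, b; cbn [letter_index]; intros H; try reflexivity; try lia.
  all: assert (E : Cantor.to_nat (n, n0) = Cantor.to_nat (n1, n2)) by lia;
    apply Cantor.to_nat_inj in E; congruence.
Qed.

Definition digits (a : letter) : list bool := repeat true (letter_index a) ++ [false].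

(** The leading [true] digits count the index and the first [false] ends the letter. *)
Lemma digits_prefix_free a b w1 w2 : digits a ++ w1 = digits b ++ w2 -> a = b /\ w1 = w2.
Proof.
  enough (H : forall m n, (repeat true m ++ [false]) ++ w1 = (repeat true n ++ [false]) ++ w2 ->
                m = n /\ w1 = w2).
  { intros E. apply H in E. destruct E as [E ->]. now apply letter_index_injective in E. }
  induction m as [|m IH]; destruct n as [|n]; simpl; intros E; try discriminate.
  - split; congruence.
  - injection E as E. apply IH in E. destruct E. auto.
Qed.

Lemma digits_nonempty a w : digits a ++ w <> [].
Proof. unfold digits. destruct (repeat true (letter_index a)); discriminate. Qed.

Lemma flat_map_digits_injective w1 : forall w2,
  flat_map digits w1 = flat_map digits w2 -> w1 = w2.
Proof.
  induction w1 as [|a w1 IH]; destruct w2 as [|b w2]; simpl; intros H.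
  - reflexivity.
  - symmetry in H. now apply digits_nonempty in H.
  - now apply digits_nonempty in H.
  - apply digits_prefix_free in H. destruct H as [-> H]. f_equal. auto.
Qed.

Definition rule : Type := (list letter * list letter)%type.

Definition rule_tile (t : rule) : tile :=
  (flat_map digits (fst t), flat_map digits (snd t)).

Definition word_number (w : list letter) : nat := push (flat_map digits w) 0.

Lemma word_number_app w v :
  word_number (w ++ v) = push (flat_map digits v) (word_number w).
Proof. unfold word_number. now rewrite flat_map_app, push_app. Qed.

(** Passes from numbers to words: [Y] is the initial word followed by all that is written, [Z] is
    all that is read. The last rule is peeled off, since [push] appends at the end. *)
Lemma reach_words (rules : list rule) w0 Y Z :
  reach (map rule_tile rules) (word_number w0) Y Z <->
  exists ts, incl ts rules /\ Y = word_number (w0 ++ flat_map snd ts) /\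
             Z = word_number (flat_map fst ts).
Proof.
  assert (Hsnoc : forall (f : rule -> list letter) ts t,
    flat_map f (ts ++ [t]) = flat_map f ts ++ f t).
  { intros f ts t. rewrite flat_map_app. simpl. now rewrite app_nil_r. }
  split.
  - induction 1 as [|Y Z u v _ (ts & Hts & -> & ->) Hin].
    + exists []. simpl. rewrite app_nil_r. repeat split. apply incl_nil_l.
    + apply in_map_iff in Hin. destruct Hin as (t & Et & Ht).
      injection Et as <- <-. exists (ts ++ [t]).
      rewrite !Hsnoc, app_assoc, !word_number_app. repeat split.
      apply incl_app; [exact Hts|]. now intros t' [<-|[]].
  - intros (ts & Hts & -> & ->). induction ts as [|t ts IH] using rev_ind.
    + simpl. rewrite app_nil_r. constructor.
    + rewrite !Hsnoc, app_assoc, (word_number_app _ (snd t)), (word_number_app _ (fst t)).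
      apply reach_tile.
      * apply IH. intros t' Ht'. apply Hts, in_or_app. auto.
      * apply (in_map rule_tile rules t), Hts, in_or_app. simpl. auto.
Qed.

Inductive steps (P : program) : mstate -> mstate -> Prop :=
| steps_refl s : steps P s s
| steps_cons s s1 s2 : step P s = Some s1 -> steps P s1 s2 -> steps P s s2.

Lemma steps_trans P s1 s2 s3 : steps P s1 s2 -> steps P s2 s3 -> steps P s1 s3.
Proof. induction 1; [auto|]. intros. econstructor; eauto. Qed.

Lemma steps_snoc P s1 s2 s3 : steps P s1 s2 -> step P s2 = Some s3 -> steps P s1 s3.
Proof.
  intros H1 H2. apply steps_trans with s2; [exact H1|].
  econstructor; [exact H2 | constructor].
Qed.

Lemma run_steps P k : forall s t, run P k s = Some t -> steps P s t /\ step P t = None.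
Proof.
  induction k as [|k IH]; simpl; intros s t H; [discriminate|].
  destruct (step P s) as [s1|] eqn:E.
  - apply IH in H. destruct H. split; [econstructor; eauto | assumption].
  - injection H as <-. split; [constructor | exact E].
Qed.

Definition halts (P : program) (s : mstate) : Prop := exists t, steps P s t /\ step P t = None.

Definition target (I : instr) : nat := match I with INC r => r | DEC r _ => r end.

Definition tape_letter (a : letter) : Prop := a = LOne \/ a = LHash.

(** * Simulation of a counter machine by a queue *)

Section Tape.
Context (Q : program).

Definition nregs : nat := S (list_max (map target Q)).

Lemma target_lt q I : nth_error Q q = Some I -> target I < nregs.
Proof.
  intros H. apply nth_error_In in H. unfold nregs.
  pose proof (proj1 (list_max_le (map target Q) _) (le_n _)) as F.
  rewrite Forall_forall in F. specialize (F (target I) (in_map target _ _ H)). lia.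
Qed.

(** Instruction [q] is about to start with the head at block boundary [i]. Boundary 0 is the same as
    [nregs] on the circular tape, and execution begins there; from other boundaries the head first
    moves on to 0. A [q] outside the program means halting. *)
Definition head (q i : nat) : letter :=
  if q <? length Q then match i with 0 => LBusy q nregs | S _ => LMove q i end else LHalt.

(** The head [h] consumes the next letter [a], writes a word at the far end and becomes a new head.
    [INC r] adds a [LOne] when it meets the [LHash] closing block [r]; [DEC r j] deletes the first
    [LOne] of block [r], or jumps if there is none; [LHalt] erases the tape. *)
Definition transition (h a : letter) : option (list letter * letter) :=
  match h, a with
  | LHalt, LOne | LHalt, LHash => Some ([], LHalt)
  | LMove q (S i), LOne => Some ([LOne], LMove q (S i))
  | LMove q (S i), LHash => Some ([LHash], head q i)
  | LBusy q (S i), LOne =>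
      match nth_error Q q with
      | None => None
      | Some (INC r) => Some ([LOne], LBusy q (S i))
      | Some (DEC r j) =>
          if i =? r then Some ([], head (S q) (S i)) else Some ([LOne], LBusy q (S i))
      end
  | LBusy q (S i), LHash =>
      match nth_error Q q with
      | None => None
      | Some (INC r) =>
          if i =? r then Some ([LOne; LHash], head (S q) i) else Some ([LHash], LBusy q i)
      | Some (DEC r j) =>
          if i =? r then Some ([LHash], head j i) else Some ([LHash], LBusy q i)
      end
  | _, _ => None
  end.

Definition heads : list letter :=
  LHalt :: flat_map (fun q => flat_map (fun i => [LBusy q (S i); LMove q (S i)]) (seq 0 nregs))
             (seq 0 (length Q)).

Definition transition_rule (p : letter * letter) : list rule :=
  match transition (fst p) (snd p) with
  | Some (v, h) => [([fst p; snd p], v ++ [h])]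
  | None => []
  end.

(** The first rule closes the input block and supplies the first head and the empty blocks of the
    other registers. Two rules rotate tape letters, and the fourth removes the halting head, so that
    the queue can become empty. *)
Definition rules : list rule :=
  ([LStart], LHash :: head 0 0 :: repeat LHash (pred nregs)) ::
  ([LOne], [LOne]) :: ([LHash], [LHash]) :: ([LHalt], []) ::
  flat_map transition_rule (list_prod heads [LOne; LHash]).

Lemma heads_busy q i : q < length Q -> i < nregs -> In (LBusy q (S i)) heads.
Proof.
  intros Hq Hi. right. apply in_flat_map. exists q. split; [apply in_seq; lia|].
  apply in_flat_map. exists i. split; [apply in_seq; lia | simpl; auto].
Qed.

Lemma heads_move q i : q < length Q -> i < nregs -> In (LMove q (S i)) heads.
Proof.
  intros Hq Hi. right. apply in_flat_map. exists q. split; [apply in_seq; lia|].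
  apply in_flat_map. exists i. split; [apply in_seq; lia | simpl; auto].
Qed.

Lemma rules_inv u v : In (u, v) rules ->
  (u = [LStart] /\ v = LHash :: head 0 0 :: repeat LHash (pred nregs)) \/
  (exists a, tape_letter a /\ u = [a] /\ v = [a]) \/ (u = [LHalt] /\ v = []) \/
  (exists h a v' h', ~ tape_letter h /\ h <> LStart /\ u = [h; a] /\ v = v' ++ [h'] /\
     transition h a = Some (v', h')).
Proof.
  unfold tape_letter. intros [H|[H|[H|[H|H]]]].
  1-4: injection H as <- <-; eauto 8.
  right; right; right. apply in_flat_map in H. destruct H as ((h & a) & Hp & H).
  unfold transition_rule in H. cbn [fst snd] in H.
  destruct (transition h a) as [[v' h']|] eqn:E; [|destruct H].
  destruct H as [H|[]]. injection H as <- <-. exists h, a, v', h'.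
  repeat split; auto; destruct h; try discriminate; intros [H|H]; discriminate.
Qed.

Lemma transition_writes h a v h' : transition h a = Some (v, h') -> Forall tape_letter v.
Proof.
  unfold transition, tape_letter. intros H.
  destruct h as [| | | |q [|i]|q [|i]], a; try discriminate H;
    try destruct (nth_error Q q) as [[r|r j]|]; try discriminate H;
    try destruct (i =? r); injection H as <- <-; auto.
Qed.

Fixpoint lower_blocks (regs : nat -> nat) (i : nat) : list letter :=
  match i with
  | 0 => []
  | S i => repeat LOne (regs i) ++ LHash :: lower_blocks regs i
  end.

Fixpoint upper_blocks (regs : nat -> nat) (i d : nat) : list letter :=
  match d with
  | 0 => []
  | S d => upper_blocks regs (S i) d ++ repeat LOne (regs i) ++ [LHash]
  end.

(** The circular tape seen from inside block [i]: [m] of its ones are still ahead, and [k] have been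
    passed and sit at the far end. Register [i] itself enters only through [m] and [k]. *)
Definition tape (regs : nat -> nat) (i m k : nat) : list letter :=
  repeat LOne m ++ LHash :: lower_blocks regs i ++
  upper_blocks regs (S i) (nregs - S i) ++ repeat LOne k.

Definition tape_at (regs : nat -> nat) (i : nat) : list letter :=
  lower_blocks regs i ++ upper_blocks regs i (nregs - i).

Lemma lower_blocks_ext regs regs' i :
  (forall j, j < i -> regs j = regs' j) -> lower_blocks regs i = lower_blocks regs' i.
Proof.
  induction i as [|i IH]; intros H; simpl; [reflexivity|].
  rewrite (H i), IH; auto.
Qed.

Lemma upper_blocks_ext regs regs' d : forall i,
  (forall j, i <= j -> regs j = regs' j) -> upper_blocks regs i d = upper_blocks regs' i d.
Proof.
  induction d as [|d IH]; intros i H; simpl; [reflexivity|].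
  rewrite (H i), (IH (S i)); auto with arith.
Qed.

Lemma upper_lower_blocks regs d : forall i,
  upper_blocks regs i d ++ lower_blocks regs i = lower_blocks regs (d + i).
Proof.
  induction d as [|d IH]; intros i; [reflexivity|]. cbn [upper_blocks].
  specialize (IH (S i)). rewrite Nat.add_succ_r in IH. cbn [Nat.add]. rewrite <- IH.
  cbn [lower_blocks]. now rewrite <- !app_assoc.
Qed.

Lemma tape_at_wrap regs : tape_at regs 0 = tape_at regs nregs.
Proof.
  unfold tape_at. rewrite Nat.sub_diag. cbn [lower_blocks upper_blocks app].
  rewrite app_nil_r, Nat.sub_0_r.
  pose proof (upper_lower_blocks regs nregs 0) as H. cbn [lower_blocks] in H.
  now rewrite app_nil_r, Nat.add_0_r in H.
Qed.

Lemma tape_at_succ regs i : tape_at regs (S i) = tape regs i (regs i) 0.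
Proof.
  unfold tape_at, tape. cbn [lower_blocks repeat]. now rewrite app_nil_r, <- app_assoc.
Qed.

Lemma tape_at_read regs i : i < nregs ->
  lower_blocks regs i ++ upper_blocks regs (S i) (nregs - S i) ++
    repeat LOne (regs i) ++ [LHash] = tape_at regs i.
Proof.
  intros Hi. unfold tape_at. replace (nregs - i) with (S (nregs - S i)) by lia. reflexivity.
Qed.

Lemma tape_ext regs regs' i m k :
  (forall j, j <> i -> regs j = regs' j) -> tape regs i m k = tape regs' i m k.
Proof.
  intros H. unfold tape. rewrite (lower_blocks_ext regs regs' i).
  - rewrite (upper_blocks_ext regs regs' _ (S i)); [reflexivity|].
    intros j Hj. apply H. lia.
  - intros j Hj. apply H. lia.
Qed.

Lemma repeat_tape_letter m : Forall tape_letter (repeat LOne m).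
Proof. apply Forall_forall. intros a Ha. apply repeat_spec in Ha. now left. Qed.

Lemma tape_letters regs i m k : Forall tape_letter (tape regs i m k).
Proof.
  assert (Hh : tape_letter LHash) by now right.
  assert (Hl : Forall tape_letter (lower_blocks regs i)).
  { induction i; simpl; [constructor|]. apply Forall_app. split.
    - apply repeat_tape_letter.
    - constructor; assumption. }
  assert (Hu : forall d j, Forall tape_letter (upper_blocks regs j d)).
  { induction d; intros j; simpl; [constructor|]. rewrite !Forall_app.
    auto using repeat_tape_letter. }
  unfold tape. apply Forall_app. split; [apply repeat_tape_letter|].
  constructor; [exact Hh|]. rewrite !Forall_app. auto using repeat_tape_letter.
Qed.

Lemma upd_same regs r x : upd regs r x r = x.
Proof. unfold upd. now rewrite Nat.eqb_refl. Qed.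

Lemma upd_other regs r x j : j <> r -> upd regs r x j = regs j.
Proof. unfold upd. intros H. now rewrite (proj2 (Nat.eqb_neq j r) H). Qed.

Lemma tape_at_inc regs i : i < nregs ->
  lower_blocks regs i ++ upper_blocks regs (S i) (nregs - S i) ++
    repeat LOne (regs i) ++ [LOne; LHash] = tape_at (upd regs i (S (regs i))) i.
Proof.
  intros Hi. rewrite <- tape_at_read by exact Hi. rewrite upd_same.
  set (regs' := upd regs i (S (regs i))).
  rewrite (lower_blocks_ext regs' regs i), (upper_blocks_ext regs' regs _ (S i)).
  - rewrite <- (Nat.add_1_r (regs i)), repeat_app. simpl. now rewrite <- !app_assoc.
  - intros j Hj. apply upd_other. lia.
  - intros j Hj. apply upd_other. lia.
Qed.

(** Invariant of the simulation: the machine really reaches [q] with [regs]. A busy head has not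
    passed its target block, and for [DEC] no one of that block has been passed, since the first
    would have been deleted. *)
Inductive valid (s0 : mstate) : letter -> list letter -> Prop :=
| valid_busy q regs I i m k :
    steps Q s0 (q, regs) -> nth_error Q q = Some I -> i < nregs -> target I <= i ->
    m + k = regs i -> (target I = i -> match I with DEC _ _ => k = 0 | INC _ => True end) ->
    valid s0 (LBusy q (S i)) (tape regs i m k)
| valid_move q regs i m k :
    steps Q s0 (q, regs) -> i < nregs -> m + k = regs i ->
    valid s0 (LMove q (S i)) (tape regs i m k).

Lemma valid_head s0 q regs i : steps Q s0 (q, regs) -> i <= nregs ->
  halts Q s0 \/ valid s0 (head q i) (tape_at regs i).
Proof.
  intros Hs Hi. unfold head. destruct (Nat.ltb_spec q (length Q)) as [Hq|Hq].
  - right. destruct i as [|i].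
    + rewrite tape_at_wrap. unfold nregs at 1 2. rewrite tape_at_succ.
      destruct (nth_error Q q) as [I|] eqn:E.
      * pose proof (target_lt q I E). unfold nregs in *.
        apply valid_busy with I; try assumption; unfold nregs; try lia.
        intros _. now destruct I.
      * apply nth_error_None in E. lia.
    + rewrite tape_at_succ. apply valid_move; [assumption|lia|lia].
  - left. exists (q, regs). split; [exact Hs|]. unfold step.
    now rewrite (proj2 (nth_error_None Q q) Hq).
Qed.

Lemma app_assoc_four (B C : list letter) (k : nat) v :
  (B ++ C ++ repeat LOne k) ++ v = B ++ C ++ repeat LOne k ++ v.
Proof. now rewrite <- !app_assoc. Qed.

Lemma tape_rotate regs i m k :
  (repeat LOne m ++ LHash :: lower_blocks regs i ++
    upper_blocks regs (S i) (nregs - S i) ++ repeat LOne k) ++ [LOne] = tape regs i m (S k).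
Proof.
  unfold tape. rewrite <- (Nat.add_1_r k), repeat_app.
  rewrite <- app_assoc. cbn [app]. now rewrite <- !app_assoc.
Qed.

(** A head transition corresponds to a machine step when the target block is changed or found empty,
    and to no step otherwise; the alternative [halts] arises when a new instruction lies outside the
    program. *)
Lemma valid_transition s0 h a body v h' :
  valid s0 h (a :: body) -> transition h a = Some (v, h') ->
  halts Q s0 \/ valid s0 h' (body ++ v).
Proof.
  intros Hv Ht. remember (a :: body) as full eqn:E.
  destruct Hv as [q regs I i m k Hs HI Hi Htar Hmk Hk|q regs i m k Hs Hi Hmk].
  - destruct m as [|m]; unfold tape in E; cbn [repeat app] in E; injection E as <- <-;
      cbn [transition] in Ht; rewrite HI in Ht.
    + simpl in Hmk. subst k. rewrite app_assoc_four.
      assert (Hpass : target I <> i ->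
        valid s0 (LBusy q i) (lower_blocks regs i ++ upper_blocks regs (S i) (nregs - S i) ++
          repeat LOne (regs i) ++ [LHash])).
      (* The target is at most [i] and differs from it, so [i] is positive and the sweep goes on in
         the block below. *)
      { intros Hne. rewrite tape_at_read by exact Hi. destruct i as [|i]; [lia|].
        rewrite tape_at_succ. apply valid_busy with I; try assumption; try lia.
        now destruct I. }
      destruct I as [r|r j]; destruct (Nat.eqb_spec i r) as [->|Hne];
        injection Ht as <- <-; cbn [target] in *; try (right; apply Hpass; congruence).
      * rewrite tape_at_inc by exact Hi. apply valid_head; [|lia].
        eapply steps_snoc; [exact Hs|]. unfold step. now rewrite HI.
      * rewrite tape_at_read by exact Hi. apply valid_head; [|lia].
        eapply steps_snoc; [exact Hs|]. unfold step. rewrite HI.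
        (* No one has been seen in block [r], so the register is 0 and the jump is taken. *)
        now rewrite (Hk eq_refl).
    + assert (Hpass : (target I = i -> match I with DEC _ _ => False | INC _ => True end) ->
        valid s0 (LBusy q (S i)) ((repeat LOne m ++ LHash :: lower_blocks regs i ++
          upper_blocks regs (S i) (nregs - S i) ++ repeat LOne k) ++ [LOne])).
      { intros HD. rewrite tape_rotate. apply valid_busy with I; try assumption; try lia.
        intros He. specialize (HD He). now destruct I. }
      destruct I as [r|r j]; [|destruct (Nat.eqb_spec i r) as [->|Hne]];
        injection Ht as <- <-; cbn [target] in *.
      * right. now apply Hpass.
      * specialize (Hk eq_refl). subst k. rewrite Nat.add_0_r in Hmk.
        assert (Hs' : steps Q s0 (S q, upd regs r m)).
        { eapply steps_snoc; [exact Hs|]. unfold step. rewrite HI. now rewrite <- Hmk. }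
        destruct (valid_head s0 _ _ (S r) Hs') as [H|H]; [lia|now left|right].
        rewrite tape_at_succ, upd_same in H.
        rewrite (tape_ext _ regs) in H; [now rewrite app_nil_r|].
        intros j' Hj'. now apply upd_other.
      * right. apply Hpass. congruence.
  - destruct m as [|m]; unfold tape in E; cbn [repeat app] in E; injection E as <- <-;
      cbn [transition] in Ht; injection Ht as <- <-.
    + simpl in Hmk. subst k. rewrite app_assoc_four, tape_at_read by exact Hi.
      apply valid_head; [exact Hs | lia].
    + right. rewrite tape_rotate. apply valid_move; [exact Hs|exact Hi|lia].
Qed.

Lemma valid_tape s0 h body : valid s0 h body ->
  ~ tape_letter h /\ h <> LStart /\ h <> LHalt /\ body <> [] /\ Forall tape_letter body.
Proof.
  assert (Hn : forall regs i m k, tape regs i m k <> [])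
    by (intros regs i [|m] k; discriminate).
  unfold tape_letter. destruct 1; repeat split; auto using tape_letters;
    try discriminate; intros [H'|H']; discriminate.
Qed.

(* A queue word [A ++ h :: B] stands for the head [h] facing the circular tape [B ++ A]. *)
Lemma valid_match_halts s0 ts : forall A h B,
  incl ts rules -> valid s0 h (B ++ A) ->
  (A ++ h :: B) ++ flat_map snd ts = flat_map fst ts -> halts Q s0.
Proof.
  induction ts as [|[u v] ts IH]; intros A h B Hts Hv E.
  - destruct A; discriminate E.
  - assert (Hts' : incl ts rules) by (intros t Ht; apply Hts; now right).
    destruct (valid_tape _ _ _ Hv) as (Hh & HhS & HhH & Hne & Hall).
    apply Forall_app in Hall. destruct Hall as [_ HA].
    cbn [flat_map fst snd] in E.
    destruct (rules_inv u v (Hts _ (or_introl eq_refl)))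
      as [[-> ->]|[(a & Ha & -> & ->)|[[-> ->]|(h0 & a & v' & h' & Hh0 & _ & -> & -> & Ht)]]].
    (* The front letter would be [LStart], but the queue holds only tape letters and the head. *)
    + destruct A as [|a A]; [now injection E|]. injection E as -> _.
      inversion HA as [|? ? [H|H] _]; discriminate.
    + destruct A as [|a' A].
      * injection E as -> _. contradiction.
      (* A copying rule moves the front letter to the back, which leaves the circular tape
         unchanged. *)
      * injection E as -> E. apply (IH A h (B ++ [a]) Hts').
        -- now rewrite <- app_assoc.
        -- rewrite <- E, <- !app_assoc. cbn [app]. now rewrite <- !app_assoc.
    + destruct A as [|a' A]; [now injection E|]. injection E as -> _.
      inversion HA as [|? ? [H|H] _]; discriminate.
    + destruct A as [|a' A].
      * rewrite app_nil_r in Hv, Hne. destruct B as [|b B]; [contradiction|].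
        injection E as -> -> E.
        destruct (valid_transition _ _ _ _ _ _ Hv Ht) as [H|H]; [exact H|].
        apply (IH (B ++ v') h' [] Hts' H). rewrite <- E, <- !app_assoc. reflexivity.
      * injection E as -> _. inversion HA; contradiction.
Qed.

Definition start_word (n : nat) : list letter := LStart :: repeat LOne n.

(** After the first rule the head faces the empty blocks of the higher registers, followed by the
    input block. *)
Lemma start_tape n :
  repeat LHash (pred nregs) ++ repeat LOne n ++ [LHash] = tape_at (snd (init n)) 0.
Proof.
  rewrite tape_at_wrap. unfold tape_at. rewrite Nat.sub_diag. cbn [upper_blocks].
  rewrite app_nil_r. unfold nregs. cbn [pred].
  induction (list_max (map target Q)) as [|k IH].
  - reflexivity.
  - cbn [repeat app]. rewrite IH. reflexivity.
Qed.

Lemma match_halts n ts : incl ts rules ->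
  start_word n ++ flat_map snd ts = flat_map fst ts -> halts Q (init n).
Proof.
  intros Hts E. destruct ts as [|[u v] ts]; [discriminate E|].
  cbn [flat_map fst snd] in E.
  destruct (rules_inv u v (Hts _ (or_introl eq_refl)))
    as [[-> ->]|[(a & [->| ->] & -> & ->)|[[-> ->]|(h0 & a & v' & h' & _ & Hh0 & -> & -> & _)]]];
    try discriminate E.
  - injection E as E.
    destruct (valid_head (init n) 0 (snd (init n)) 0) as [H|H]; [constructor|lia|exact H|].
    rewrite <- start_tape in H.
    apply (valid_match_halts _ ts (repeat LOne n ++ [LHash]) (head 0 0)
             (repeat LHash (pred nregs))).
    + intros t Ht. apply Hts. now right.
    + exact H.
    + rewrite <- E. rewrite <- !app_assoc. reflexivity.
  - injection E as E _. congruence.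
Qed.

(** * From halting runs to matches *)

Inductive solvable : list letter -> Prop :=
| solvable_nil : solvable []
| solvable_rule u v w : In (u, v) rules -> solvable (w ++ v) -> solvable (u ++ w).

(** When the queue is emptied by reading at the front and writing at the back, all that is read
    equals the initial word followed by all that is written. *)
Lemma solvable_match w : solvable w ->
  exists ts, incl ts rules /\ w ++ flat_map snd ts = flat_map fst ts.
Proof.
  induction 1 as [|u v w Hin _ (ts & Hts & E)].
  - exists []. split; [apply incl_nil_l | reflexivity].
  - exists ((u, v) :: ts). split; [now apply incl_cons|].
    cbn [flat_map fst snd]. now rewrite <- E, <- !app_assoc.
Qed.

Lemma solvable_rotate A : forall h B,
  Forall tape_letter A -> solvable (h :: B ++ A) -> solvable (A ++ h :: B).
Proof.
  induction A as [|a A IH]; intros h B HA H.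
  - now rewrite app_nil_r in H.
  - inversion HA as [|? ? Ha HA']; subst.
    apply (solvable_rule [a] [a] (A ++ h :: B)).
    + destruct Ha as [-> | ->]; simpl; auto.
    + rewrite <- app_assoc. apply (IH h (B ++ [a]) HA'). now rewrite <- app_assoc.
Qed.

Lemma solvable_transition h a v h' body :
  In h heads -> tape_letter a -> Forall tape_letter body ->
  transition h a = Some (v, h') -> solvable (h' :: body ++ v) -> solvable (h :: a :: body).
Proof.
  intros Hh Ha Hb Ht H. apply (solvable_rule [h; a] (v ++ [h']) body).
  - do 4 right. apply in_flat_map. exists (h, a). split.
    + apply in_prod; [exact Hh|]. destruct Ha as [-> | ->]; simpl; auto.
    + unfold transition_rule. cbn [fst snd]. rewrite Ht. now left.
  - rewrite app_assoc. apply (solvable_rotate (body ++ v) h' []).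
    + apply Forall_app. split; [exact Hb|]. eapply transition_writes, Ht.
    + exact H.
Qed.

Lemma solvable_halt body : Forall tape_letter body -> solvable (LHalt :: body).
Proof.
  induction 1 as [|a body Ha Hb IH].
  - apply (solvable_rule [LHalt] [] []); [simpl; auto | constructor].
  - apply solvable_transition with [] LHalt; try assumption.
    + now left.
    + now destruct Ha as [-> | ->].
    + now rewrite app_nil_r.
Qed.

Lemma solvable_ones h regs i m : forall k, In h heads ->
  transition h LOne = Some ([LOne], h) ->
  solvable (h :: tape regs i 0 (m + k)) -> solvable (h :: tape regs i m k).
Proof.
  induction m as [|m IH]; intros k Hh Ht H; [exact H|].
  apply solvable_transition with [LOne] h; try assumption.
  - now left.
  - apply (tape_letters regs i m k).
  - rewrite tape_rotate. apply IH; [exact Hh|exact Ht|].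
    now rewrite Nat.add_succ_r.
Qed.

Lemma tape_at_letters regs i : i <= nregs -> Forall tape_letter (tape_at regs i).
Proof.
  intros Hi. destruct i as [|i].
  - rewrite tape_at_wrap. unfold nregs at 1. rewrite tape_at_succ. apply tape_letters.
  - rewrite tape_at_succ. apply tape_letters.
Qed.

Lemma solvable_hash h h' v regs i : In h heads ->
  transition h LHash = Some (v, h') ->
  solvable (h' :: lower_blocks regs i ++ upper_blocks regs (S i) (nregs - S i) ++
              repeat LOne (regs i) ++ v) ->
  solvable (h :: tape regs i 0 (regs i)).
Proof.
  intros Hh Ht H. apply solvable_transition with v h'; try assumption.
  - now right.
  - pose proof (tape_letters regs i 0 (regs i)) as F. inversion F; assumption.
  - now rewrite app_assoc_four.
Qed.

Lemma solvable_move q regs i : i <= nregs ->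
  solvable (head q 0 :: tape_at regs 0) -> solvable (head q i :: tape_at regs i).
Proof.
  intros Hi H. unfold head in *. destruct (Nat.ltb_spec q (length Q)) as [Hq|Hq].
  - induction i as [|i IH]; [exact H|].
    assert (Hh : In (LMove q (S i)) heads) by (apply heads_move; assumption).
    rewrite tape_at_succ. apply solvable_ones; [exact Hh|reflexivity|].
    rewrite Nat.add_0_r. apply solvable_hash with (head q i) [LHash]; [exact Hh|reflexivity|].
    rewrite tape_at_read by exact Hi. unfold head.
    rewrite (proj2 (Nat.ltb_lt q (length Q)) Hq). apply IH. lia.
  - now apply solvable_halt, tape_at_letters.
Qed.

(** Above its target block a busy head only copies, so the [d] blocks are passed one at a time. *)
Lemma solvable_busy q I regs d : nth_error Q q = Some I -> target I + d < nregs ->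
  solvable (LBusy q (S (target I)) :: tape_at regs (S (target I))) ->
  solvable (LBusy q (S (target I + d)) :: tape_at regs (S (target I + d))).
Proof.
  intros HI Hd H.
  assert (Hq : q < length Q) by (apply nth_error_Some; congruence).
  induction d as [|d IH]; [now rewrite Nat.add_0_r|].
  assert (Hh : In (LBusy q (S (target I + S d))) heads) by (apply heads_busy; assumption).
  assert (Hne : (target I + S d =? target I) = false) by (apply Nat.eqb_neq; lia).
  rewrite tape_at_succ. apply solvable_ones; [exact Hh|..].
  - cbn [transition]. rewrite HI. destruct I; cbn [target] in *; [|rewrite Hne]; reflexivity.
  - rewrite Nat.add_0_r.
    apply solvable_hash with (LBusy q (target I + S d)) [LHash]; [exact Hh|..].
    + cbn [transition]. rewrite HI. destruct I; cbn [target] in *; rewrite Hne; reflexivity.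
    + rewrite tape_at_read by exact Hd. rewrite Nat.add_succ_r. apply IH. lia.
Qed.

Lemma solvable_step q regs q' regs' : step Q (q, regs) = Some (q', regs') ->
  solvable (head q' 0 :: tape_at regs' 0) -> solvable (head q 0 :: tape_at regs 0).
Proof.
  intros Hs H. unfold step in Hs. destruct (nth_error Q q) as [I|] eqn:HI; [|discriminate].
  pose proof (target_lt q I HI) as Ht.
  assert (Hq : q < length Q) by (apply nth_error_Some; congruence).
  assert (Hh : In (LBusy q (S (target I))) heads) by (apply heads_busy; assumption).
  unfold head at 1. rewrite (proj2 (Nat.ltb_lt q (length Q)) Hq), tape_at_wrap.
  replace nregs with (S (target I + (nregs - S (target I)))) by lia.
  apply solvable_busy; [exact HI|lia|]. rewrite tape_at_succ.
  destruct I as [r|r j]; cbn [target] in *.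
  - injection Hs as <- <-. apply solvable_ones; [exact Hh|..].
    + cbn [transition]. now rewrite HI.
    + rewrite Nat.add_0_r.
      apply solvable_hash with (head (S q) r) [LOne; LHash]; [exact Hh|..].
      * cbn [transition]. now rewrite HI, Nat.eqb_refl.
      * rewrite tape_at_inc by exact Ht. apply solvable_move; [lia | exact H].
  - destruct (regs r) as [|x] eqn:Er.
    + injection Hs as <- <-. rewrite <- Er at 2.
      apply solvable_hash with (head j r) [LHash]; [exact Hh|..].
      * cbn [transition]. now rewrite HI, Nat.eqb_refl.
      * rewrite tape_at_read by exact Ht. apply solvable_move; [lia | exact H].
    + injection Hs as <- <-.
      apply solvable_transition with [] (head (S q) (S r)); [exact Hh|now left|..].
      * apply (tape_letters regs r x 0).
      * cbn [transition]. now rewrite HI, Nat.eqb_refl.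
      * rewrite app_nil_r. change (solvable (head (S q) (S r) :: tape regs r x 0)).
        rewrite (tape_ext regs (upd regs r x)).
        -- replace x with (upd regs r x r) at 2 by apply upd_same.
           rewrite <- tape_at_succ. apply solvable_move; [lia | exact H].
        -- intros j' Hj'. symmetry. now apply upd_other.
Qed.

Lemma halts_match n : halts Q (init n) ->
  exists ts, incl ts rules /\ start_word n ++ flat_map snd ts = flat_map fst ts.
Proof.
  intros (t & Hs & Ht). apply solvable_match.
  apply (solvable_rule [LStart] (LHash :: head 0 0 :: repeat LHash (pred nregs))
           (repeat LOne n)); [now left|].
  replace (repeat LOne n ++ LHash :: head 0 0 :: repeat LHash (pred nregs))
    with ((repeat LOne n ++ [LHash]) ++ head 0 0 :: repeat LHash (pred nregs))
    by now rewrite <- app_assoc.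
  apply solvable_rotate.
  - apply Forall_app. split; [apply repeat_tape_letter|]. constructor; [now right|constructor].
  - rewrite start_tape. change 0 with (fst (init n)) at 1.
    induction Hs as [[q regs]|[q regs] [q1 regs1] s2 H1 _ IH]; cbn [fst snd].
    + unfold step in Ht. unfold head.
      destruct (nth_error Q q) as [[r|r j]|] eqn:E;
        [discriminate | destruct (regs r); discriminate |].
      apply nth_error_None in E. rewrite (proj2 (Nat.ltb_ge q (length Q)) E).
      apply solvable_halt, tape_at_letters. lia.
    + eapply solvable_step; [exact H1 | exact (IH Ht)].
Qed.

Definition game_tiles : list tile := map rule_tile rules.

Lemma game_tiles_nonempty u v : In (u, v) game_tiles -> u <> [].
Proof.
  intros H. apply in_map_iff in H. destruct H as ([u' v'] & E & H).
  injection E as <- <-. cbn [fst snd].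
  assert (Hne : u' <> []).
  { destruct (rules_inv u' v' H)
      as [[-> _]|[(a & _ & -> & _)|[[-> _]|(h & a & v1 & h1 & _ & _ & -> & _)]]]; discriminate. }
  destruct u' as [|a u']; [contradiction|]. apply digits_nonempty.
Qed.

(** Written so as to be the exponent denoted by [num_form], with the number of [LStart] as its
    constant. *)
Definition start_number (n : nat) : nat := push (repeat false n) (word_number [LStart]).

Lemma start_number_word n : start_number n = word_number (start_word n).
Proof.
  unfold start_number, word_number, start_word. rewrite <- push_app. f_equal.
  cbn [flat_map]. rewrite app_nil_r. f_equal.
  induction n as [|n IH]; [reflexivity|]. cbn [repeat flat_map]. now rewrite <- IH.
Qed.

Lemma game_halts n :
  (exists N, reach game_tiles (start_number n) N N) <-> halts Q (init n).
Proof.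
  rewrite start_number_word. unfold game_tiles. split.
  - intros [N H]. apply reach_words in H. destruct H as (ts & Hts & E1 & E2).
    apply (match_halts n ts Hts), flat_map_digits_injective, push_injective.
    unfold word_number in *. congruence.
  - intros H. apply halts_match in H. destruct H as (ts & Hts & E).
    exists (word_number (flat_map fst ts)). apply reach_words. exists ts.
    rewrite E. auto.
Qed.

End Tape.

(** * The diagonal machine *)

(** A loop language for writing counter machines: [CLoop r c] runs [c] until register [r] is 0,
    decrementing [r] before each round. *)
Inductive cmd : Type :=
| CSkip : cmd
| CInc : nat -> cmd
| CLoop : nat -> cmd -> cmd
| CSeq : cmd -> cmd -> cmd.

(* Register 1 stays empty, so that decrementing it is an unconditional jump. *)
Fixpoint compile (off : nat) (c : cmd) : program :=
  match c with
  | CSkip => []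
  | CInc r => [INC r]
  | CLoop r c =>
      let body := compile (S off) c in
      DEC r (S (S (off + length body))) :: body ++ [DEC 1 off]
  | CSeq c1 c2 => let p1 := compile off c1 in p1 ++ compile (off + length p1) c2
  end.

Inductive exec : cmd -> (nat -> nat) -> (nat -> nat) -> Prop :=
| exec_skip s : exec CSkip s s
| exec_inc r s : r <> 1 -> exec (CInc r) s (upd s r (S (s r)))
| exec_loop_end r c s : s r = 0 -> exec (CLoop r c) s s
| exec_loop_iter r c s x s1 s2 :
    s r = S x -> exec c (upd s r x) s1 -> exec (CLoop r c) s1 s2 -> exec (CLoop r c) s s2
| exec_seq c1 c2 s s1 s2 : exec c1 s s1 -> exec c2 s1 s2 -> exec (CSeq c1 c2) s s2.

Definition code_at (P : program) (off : nat) (l : program) : Prop :=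
  forall i, i < length l -> nth_error P (off + i) = nth_error l i.

Lemma code_at_app P off l1 l2 :
  code_at P off (l1 ++ l2) -> code_at P off l1 /\ code_at P (off + length l1) l2.
Proof.
  intros H. split; intros i Hi.
  - rewrite H by (rewrite length_app; lia). now apply nth_error_app1.
  - rewrite <- Nat.add_assoc, H by (rewrite length_app; lia).
    rewrite nth_error_app2 by lia. f_equal. lia.
Qed.

Lemma code_at_cons P off I l :
  code_at P off (I :: l) -> nth_error P off = Some I /\ code_at P (S off) l.
Proof.
  intros H. split.
  - rewrite <- (Nat.add_0_r off). apply (H 0). simpl. lia.
  - intros i Hi. rewrite Nat.add_succ_comm. apply (H (S i)). simpl. lia.
Qed.

Lemma compile_steps P c s s' : exec c s s' -> s 1 = 0 ->
  forall off, code_at P off (compile off c) ->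
  steps P (off, s) (off + length (compile off c), s') /\ s' 1 = 0.
Proof.
  induction 1 as [s|r s Hr|r c s Hr|r c s x s1 s2 Hr _ IH1 _ IH2|c1 c2 s s1 s2 _ IH1 _ IH2];
    intros H1 off Hc; cbn [compile] in *.
  - rewrite Nat.add_0_r. split; [constructor | exact H1].
  - apply code_at_cons in Hc. destruct Hc as [Hc _]. split.
    + rewrite Nat.add_1_r. eapply steps_cons; [|constructor]. unfold step. now rewrite Hc.
    + now rewrite upd_other by auto.
  - apply code_at_cons in Hc. destruct Hc as [Hc _]. split; [|exact H1].
    eapply steps_cons; [unfold step; now rewrite Hc, Hr|].
    cbn [length]. rewrite length_app. cbn [length].
    rewrite Nat.add_1_r, !Nat.add_succ_r. constructor.
  - assert (H1' : upd s r x 1 = 0) by (rewrite upd_other; congruence).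
    destruct (IH2) with (off := off) as [HS2 HZ2]; [|exact Hc|].
    + destruct (code_at_cons _ _ _ _ Hc) as [_ Hb]. apply code_at_app in Hb.
      apply (IH1 H1' (S off)), Hb.
    + split; [|exact HZ2].
      destruct (code_at_cons _ _ _ _ Hc) as [Hd Hb]. apply code_at_app in Hb.
      destruct Hb as [Hb Hj]. apply code_at_cons in Hj. destruct Hj as [Hj _].
      destruct (IH1 H1' (S off) Hb) as [HS1 HZ1].
      eapply steps_cons; [unfold step; now rewrite Hd, Hr|].
      eapply steps_trans; [exact HS1|].
      (* Register 1 is 0 after the body, so the closing [DEC] jumps back to the loop test. *)
      eapply steps_cons; [unfold step; now rewrite Hj, HZ1|]. exact HS2.
  - apply code_at_app in Hc. destruct Hc as [Hc1 Hc2].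
    destruct (IH1 H1 off Hc1) as [HS1 HZ1]. destruct (IH2 HZ1 _ Hc2) as [HS2 HZ2].
    split; [|exact HZ2]. eapply steps_trans; [exact HS1|].
    now rewrite length_app, Nat.add_assoc.
Qed.

(** * Register arithmetic and Cantor pairing *)

Ltac regs_at :=
  unfold upd;
  repeat match goal with
  | |- context [Nat.eqb ?x ?y] => destruct (Nat.eqb_spec x y); subst
  end; try congruence; try lia.

Ltac regs_eq :=
  apply functional_extensionality; let r := fresh "r" in intros r; regs_at.

Lemma exec_state c s s1 s2 : exec c s s1 -> s1 = s2 -> exec c s s2.
Proof. now intros H <-. Qed.

Lemma exec_move t a : a <> t -> a <> 1 ->
  forall n s, s t = n -> exec (CLoop t (CInc a)) s (upd (upd s a (s a + n)) t 0).
Proof.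
  intros Hat Ha. induction n as [|n IH]; intros s Hs.
  - eapply exec_state; [now apply exec_loop_end|]. regs_eq.
  - eapply exec_loop_iter; [exact Hs | now apply exec_inc|].
    eapply exec_state; [apply IH|].
    + regs_at.
    + regs_eq.
Qed.

Lemma exec_spread a b t : a <> b -> a <> t -> b <> t -> b <> 1 -> t <> 1 ->
  forall n s, s a = n ->
  exec (CLoop a (CSeq (CInc b) (CInc t))) s
    (upd (upd (upd s b (s b + n)) t (s t + n)) a 0).
Proof.
  intros Hab Hat Hbt Hb Ht. induction n as [|n IH]; intros s Hs.
  - eapply exec_state; [now apply exec_loop_end|]. regs_eq.
  - eapply exec_loop_iter; [exact Hs | eapply exec_seq; now apply exec_inc|].
    eapply exec_state; [apply IH|].
    + regs_at.
    + regs_eq.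
Qed.

(** Register 2 is scratch: it saves the contents of [a], which are then moved back. *)
Definition cadd (a b : nat) : cmd :=
  CSeq (CLoop a (CSeq (CInc b) (CInc 2))) (CLoop 2 (CInc a)).

Lemma exec_cadd a b s : a <> b -> a <> 1 -> a <> 2 -> b <> 1 -> b <> 2 -> s 2 = 0 ->
  exec (cadd a b) s (upd s b (s b + s a)).
Proof.
  intros. eapply exec_seq.
  - apply exec_spread; auto.
  - eapply exec_state; [apply exec_move; auto|]. regs_eq.
Qed.

Fixpoint cincs (r k : nat) : cmd :=
  match k with 0 => CSkip | S k => CSeq (CInc r) (cincs r k) end.

Lemma exec_cincs r k : r <> 1 -> forall s, exec (cincs r k) s (upd s r (s r + k)).
Proof.
  intros Hr. induction k as [|k IH]; intros s.
  - eapply exec_state; [apply exec_skip|]. regs_eq.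
  - eapply exec_seq; [now apply exec_inc|]. eapply exec_state; [apply IH|]. regs_eq.
Qed.

Lemma exec_cconst r k s : r <> 1 -> s r = 0 -> exec (cincs r k) s (upd s r k).
Proof.
  intros Hr H. eapply exec_state; [now apply exec_cincs|]. now rewrite H.
Qed.

Lemma exec_clear r s : exec (CLoop r CSkip) s (upd s r 0).
Proof.
  remember (s r) as n eqn:E. revert s E. induction n as [|n IH]; intros s E.
  - eapply exec_state; [now apply exec_loop_end|]. regs_eq.
  - eapply exec_loop_iter; [symmetry; exact E | apply exec_skip|].
    eapply exec_state; [apply IH; now rewrite upd_same|]. regs_eq.
Qed.

Definition triangle (n : nat) : nat := n * (n + 1) / 2.

Lemma triangle_succ n : triangle (S n) = S n + triangle n.
Proof.
  unfold triangle. replace (S n * (S n + 1)) with (S n * 2 + n * (n + 1)) by lia.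
  apply Nat.div_add_l. lia.
Qed.

(** [c] receives [b] and then the triangle number of the sum of [a] and [b]: register 3 counts down
    from that sum, and each round adds its value before the decrement. *)
Definition cpairing (a b c : nat) : cmd :=
  CSeq (cadd b c) (CSeq (cadd a 3) (CSeq (cadd b 3)
    (CLoop 3 (CSeq (cadd 3 c) (CInc c))))).

Lemma exec_triangle c : c <> 1 -> c <> 2 -> c <> 3 ->
  forall n s, s 2 = 0 -> s 3 = n ->
  exec (CLoop 3 (CSeq (cadd 3 c) (CInc c))) s (upd (upd s c (s c + triangle n)) 3 0).
Proof.
  intros H1 H2 H3. induction n as [|n IH]; intros s Hs2 Hs3.
  - eapply exec_state; [now apply exec_loop_end|].
    replace (triangle 0) with 0 by reflexivity. regs_eq.
  - eapply exec_loop_iter; [exact Hs3 | |].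
    + eapply exec_seq; [apply exec_cadd; auto; regs_at
                       | now apply exec_inc].
    + eapply exec_state; [apply IH; regs_at|].
      rewrite triangle_succ. regs_eq.
Qed.

Definition plain (r : nat) : Prop := r <> 1 /\ r <> 2 /\ r <> 3.

Lemma exec_cpairing a b c s x y : plain a -> plain b -> plain c -> a <> c -> b <> c ->
  s 2 = 0 -> s 3 = 0 -> s c = 0 -> s a = x -> s b = y ->
  exec (cpairing a b c) s (upd s c (cpair x y)).
Proof.
  intros (Ha1 & Ha2 & Ha3) (Hb1 & Hb2 & Hb3) (Hc1 & Hc2 & Hc3) Hac Hbc H2 H3 Hc Hx Hy.
  unfold cpairing. eapply exec_seq; [apply exec_cadd; auto|].
  eapply exec_seq; [apply exec_cadd; auto; regs_at|].
  eapply exec_seq; [apply exec_cadd; auto; regs_at|].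
  eapply exec_state; [apply (exec_triangle c Hc1 Hc2 Hc3 (x + y))|].
  - regs_at.
  - regs_at.
  - unfold cpair. fold (triangle (x + y)). regs_eq.
Qed.

Ltac eval_regs :=
  lazymatch goal with
  | |- ?l = ?x => let v := eval cbn [upd Nat.eqb] in l in change (v = x); eauto
  end.

Ltac exec_pair := apply exec_cpairing; [unfold plain; lia ..| eval_regs | eval_regs
  | eval_regs | eval_regs | eval_regs].

(** * Computing the code of an instance *)

Section Builder.
Context (c0 cy cbox cgoal : nat).

(** Takes the code of [u] to that of [FProd (FProd u u) fx], the step of [num_form]: 5 is the tag of
    [FProd], and [fx] has code 0. *)
Definition double_code (m : nat) : nat := cpair 5 (cpair (cpair 5 (cpair m m)) 0).

(** Register 6 holds the tag 5 and register 10 the code 0 of [fx]; registers 7 to 9 are scratch,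
    cleared for the next round. *)
Definition double_cmd : cmd :=
  CSeq (cpairing 5 5 7) (CSeq (cpairing 6 7 8) (CSeq (cpairing 8 10 9)
    (CSeq (CLoop 5 CSkip) (CSeq (cpairing 6 9 5)
      (CSeq (CLoop 7 CSkip) (CSeq (CLoop 8 CSkip) (CLoop 9 CSkip))))))).

Lemma exec_double s m : s 2 = 0 -> s 3 = 0 -> s 7 = 0 -> s 8 = 0 -> s 9 = 0 -> s 10 = 0 ->
  s 6 = 5 -> s 5 = m -> exec double_cmd s (upd s 5 (double_code m)).
Proof.
  intros. unfold double_cmd.
  do 3 (eapply exec_seq; [exec_pair|]).
  eapply exec_seq; [apply exec_clear|].
  eapply exec_seq; [exec_pair|].
  do 2 (eapply exec_seq; [apply exec_clear|]).
  eapply exec_state; [apply exec_clear|]. unfold double_code.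
  set (z := cpair 5 _). regs_eq.
Qed.

Lemma exec_double_loop n : forall s m,
  s 2 = 0 -> s 3 = 0 -> s 7 = 0 -> s 8 = 0 -> s 9 = 0 -> s 10 = 0 ->
  s 6 = 5 -> s 5 = m -> s 4 = n ->
  exec (CLoop 4 double_cmd) s (upd (upd s 5 (Nat.iter n double_code m)) 4 0).
Proof.
  induction n as [|n IH]; intros s m H2 H3 H7 H8 H9 H10 H6 H5 H4.
  - eapply exec_state; [now apply exec_loop_end|]. cbn [Nat.iter nat_rect]. regs_eq.
  - eapply exec_loop_iter; [exact H4 | apply exec_double; eval_regs |].
    eapply exec_state; [apply IH; eval_regs|].
    rewrite Nat.iter_succ_r. regs_eq.
Qed.

(** [m] is the code of the formula inside [start_form] and [n] that of the list of remaining
    formulas; 7, 6 and 3 are the tags of [FBox], [FImp] and [FAnd]. *)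
Definition input_code (m n : nat) : nat :=
  cpair (S (cpair
    (cpair 7 (cpair 6 (cpair cbox
      (cpair 3 (cpair (cpair 6 (cpair cy m)) (cpair 6 (cpair m cy))))))) n)) cgoal.

(** The input [n] is used twice: copied to register 4 it counts the rounds that build the numeral,
    and in register 0 it serves as the code of the remaining formulas. The result is left in
    register 27. *)
Definition builder : cmd :=
  CSeq (cadd 0 4) (CSeq (cincs 5 c0) (CSeq (cincs 6 5) (CSeq (CLoop 4 double_cmd)
  (CSeq (cincs 11 cy) (CSeq (cincs 12 6) (CSeq (cincs 13 3) (CSeq (cincs 14 cbox)
  (CSeq (cincs 15 7) (CSeq (cincs 16 cgoal)
  (CSeq (cpairing 11 5 17) (CSeq (cpairing 12 17 18)
  (CSeq (cpairing 5 11 19) (CSeq (cpairing 12 19 20)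
  (CSeq (cpairing 18 20 21) (CSeq (cpairing 13 21 22)
  (CSeq (cpairing 14 22 23) (CSeq (cpairing 12 23 24)
  (CSeq (cpairing 15 24 25) (CSeq (cpairing 25 0 26) (CSeq (CInc 26)
  (cpairing 26 16 27))))))))))))))))))))).

Lemma exec_builder n : exists s, exec builder (snd (init n)) s /\
  s 27 = input_code (Nat.iter n double_code c0) n /\ forall r, 27 < r -> s r = 0.
Proof.
  assert (Hz : forall r, r <> 0 -> snd (init n) r = 0).
  { intros r Hr. simpl. now rewrite (proj2 (Nat.eqb_neq r 0) Hr). }
  assert (H0 : snd (init n) 0 = n) by reflexivity.
  generalize dependent (snd (init n)). intros s Hz H0.
  (* The final state is left open and is filled in by executing the commands. *)
  eexists. split; [|split].
  - unfold builder.
    eapply exec_seq; [apply exec_cadd; try lia; now apply Hz|].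
    rewrite H0, (Hz 4) by lia. cbn [Nat.add].
    do 2 (eapply exec_seq; [apply exec_cconst; [lia | eval_regs]|]).
    eapply exec_seq; [apply exec_double_loop; eval_regs|].
    do 6 (eapply exec_seq; [apply exec_cconst; [lia | eval_regs]|]).
    do 10 (eapply exec_seq; [exec_pair|]).
    eapply exec_seq; [apply exec_inc; lia|].
    rewrite upd_same. exec_pair.
  - rewrite upd_same. reflexivity.
  - intros r Hr. repeat (rewrite upd_other by lia). apply Hz. lia.
Qed.

End Builder.

(** * Running the decider on the output of the builder *)

Section Diagonal.
Context (pre P : program).

(** [P] works on the registers from 27 on, so its input register is the builder's output. Jumps out
    of [P] are clipped to its end, where the tail instruction sits. *)
Definition relocate (I : instr) : instr :=
  match I with
  | INC r => INC (27 + r)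
  | DEC r j => DEC (27 + r) (length pre + Nat.min j (length P))
  end.

Definition tail_pc : nat := length pre + length P.

(* The last instruction jumps to itself while register 27, the answer of [P], is 0. *)
Definition diagonal : program := pre ++ map relocate P ++ [DEC 27 tail_pc].

Lemma relocate_step pc regs pc' regs' s :
  step P (pc, regs) = Some (pc', regs') -> (forall r, s (27 + r) = regs r) ->
  exists s', step diagonal (length pre + Nat.min pc (length P), s) =
               Some (length pre + Nat.min pc' (length P), s') /\
    forall r, s' (27 + r) = regs' r.
Proof.
  intros H Hs. unfold step in H. destruct (nth_error P pc) as [I|] eqn:E; [|discriminate].
  assert (Hpc : pc < length P) by (apply nth_error_Some; congruence).
  assert (EQ : nth_error diagonal (length pre + Nat.min pc (length P)) = Some (relocate I)).
  { rewrite Nat.min_l by lia. unfold diagonal.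
    rewrite nth_error_app2, Nat.add_comm, Nat.add_sub by lia.
    rewrite nth_error_app1 by (rewrite length_map; lia).
    now apply map_nth_error. }
  assert (Hupd : forall r x r', upd s (27 + r) x (27 + r') = upd regs r x r').
  { intros r x r'. unfold upd. rewrite Hs.
    destruct (Nat.eqb_spec (27 + r') (27 + r)), (Nat.eqb_spec r' r); lia. }
  assert (Hnext : S (length pre + Nat.min pc (length P)) =
                  length pre + Nat.min (S pc) (length P)) by lia.
  unfold step. rewrite EQ. destruct I as [r|r j]; unfold relocate.
  - injection H as <- <-. rewrite Hnext, Hs. eauto.
  - rewrite Hs. destruct (regs r) as [|x]; injection H as <- <-; [eauto|].
    rewrite Hnext. eauto.
Qed.

Lemma relocate_steps st st' : steps P st st' ->
  forall s, (forall r, s (27 + r) = snd st r) ->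
  exists s', steps diagonal (length pre + Nat.min (fst st) (length P), s)
               (length pre + Nat.min (fst st') (length P), s') /\
    forall r, s' (27 + r) = snd st' r.
Proof.
  induction 1 as [st|[pc regs] [pc1 regs1] st2 H1 _ IH]; intros s Hs.
  - exists s. split; [constructor | exact Hs].
  - destruct (relocate_step _ _ _ _ s H1 Hs) as (s1 & E1 & Hs1).
    destruct (IH s1 Hs1) as (s2 & E2 & Hs2). exists s2. split; [|exact Hs2].
    econstructor; [exact E1 | exact E2].
Qed.

(** With [x] in register 27 and nothing above it, the copy of [P] starts from [init x]; when [P]
    halts, its counter has left the program and is clipped to the tail. *)
Lemma diagonal_reaches_tail n x m s :
  steps diagonal (init n) (length pre, s) -> s 27 = x -> (forall r, 27 < r -> s r = 0) ->
  halts_with P x m ->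
  exists s', steps diagonal (init n) (tail_pc, s') /\ s' 27 = m.
Proof.
  intros Hpre Hx Hz (k & [pc regs] & Hrun & Hm). apply run_steps in Hrun.
  destruct Hrun as [Hst Hhalt].
  destruct (relocate_steps _ _ Hst s) as (s' & Hs' & Hrel).
  - intros [|r]; [exact Hx|]. apply Hz. lia.
  - exists s'. cbn [fst snd] in *. split.
    + eapply steps_trans; [exact Hpre|]. cbn [Nat.min] in Hs'. rewrite Nat.add_0_r in Hs'.
      unfold tail_pc. replace (length P) with (Nat.min pc (length P)); [exact Hs'|].
      apply Nat.min_r. unfold step in Hhalt.
      destruct (nth_error P pc) as [[r|r j]|] eqn:E;
        [discriminate | destruct (regs r); discriminate |].
      now apply nth_error_None.
    + rewrite <- Hm. apply (Hrel 0).
Qed.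

Lemma nth_error_tail : nth_error diagonal tail_pc = Some (DEC 27 tail_pc).
Proof.
  unfold diagonal, tail_pc. rewrite nth_error_app2, Nat.add_comm, Nat.add_sub by lia.
  rewrite nth_error_app2; rewrite length_map; [|lia]. now rewrite Nat.sub_diag.
Qed.

Lemma tail_halts s : s 27 = 1 -> halts diagonal (tail_pc, s).
Proof.
  intros H. exists (S tail_pc, upd s 27 0). split.
  - eapply steps_cons; [|constructor]. unfold step. now rewrite nth_error_tail, H.
  - unfold step. rewrite (proj2 (nth_error_None diagonal (S tail_pc))); [reflexivity|].
    unfold diagonal, tail_pc. rewrite !length_app, length_map. simpl. lia.
Qed.

Lemma tail_loops s : s 27 = 0 -> ~ halts diagonal (tail_pc, s).
Proof.
  intros H (t & Hs & Ht).
  assert (E : step diagonal (tail_pc, s) = Some (tail_pc, s))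
    by (unfold step; now rewrite nth_error_tail, H).
  remember (tail_pc, s) as st eqn:Est.
  induction Hs as [st|st s1 s2 H1 _ IH]; [congruence|]. apply IH; congruence.
Qed.

Lemma halts_steps Q s t : steps Q s t -> halts Q s -> halts Q t.
Proof.
  induction 1 as [s|s s1 s2 H1 _ IH]; [auto|]. intros (t & Hs & Ht). apply IH.
  inversion Hs; subst; [congruence|]. exists t. split; [congruence | exact Ht].
Qed.

End Diagonal.

(** * The diagonal argument *)

Lemma enc_num_form c n :
  enc_form (num_form c n) = Nat.iter n double_code (enc_form (fpow fx c)).
Proof.
  induction n as [|n IH]; [reflexivity|]. cbn [num_form enc_form Nat.iter nat_rect].
  fold (Nat.iter n double_code (enc_form (fpow fx c))). rewrite <- IH. reflexivity.
Qed.

(* Closed codes are astronomically large unary numbers; rewriting with open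
   equations avoids evaluating them. *)
Lemma enc_game_input c n G :
  enc_input (start_form (num_form c n) :: G) goal_form =
  input_code (enc_form fy) (enc_form (FBox FZero)) (enc_form goal_form)
    (enc_form (num_form c n)) (enc_list G).
Proof.
  assert (Hbox : forall f, enc_form (FBox f) = cpair 7 (enc_form f)) by reflexivity.
  assert (Himp : forall f g, enc_form (FImp f g) = cpair 6 (cpair (enc_form f) (enc_form g)))
    by reflexivity.
  assert (Hand : forall f g, enc_form (FAnd f g) = cpair 3 (cpair (enc_form f) (enc_form g)))
    by reflexivity.
  assert (Hcons : forall f l, enc_list (f :: l) = S (cpair (enc_form f) (enc_list l)))
    by reflexivity.
  unfold enc_input, start_form, input_code. rewrite Hcons.
  generalize (num_form c n) as u, goal_form as g, fy as y, (FBox FZero) as b.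
  intros u g y b. now rewrite Hbox, Himp, Hand, !Himp.
Qed.

(* The codes are variables with defining equations, so that the kernel cannot unfold them. *)
Lemma diagonal_contradiction (A : FLew -> Prop) (S : list form -> form -> Prop)
  (P pre : program) (c c0 cy cbox cgoal n : nat) (G Gn : list form) :
  c = word_number [LStart] -> c0 = enc_form (fpow fx c) -> cy = enc_form fy ->
  cbox = enc_form (FBox FZero) -> cgoal = enc_form goal_form ->
  pre = compile 0 (builder c0 cy cbox cgoal) ->
  G = game_forms (game_tiles (diagonal pre P)) -> n = enc_list G ->
  Gn = start_form (num_form c n) :: G ->
  (forall X, A X -> weakly_archimedean X /\ linearly_ordered X) ->
  (forall n : nat, exists X, A X /\ exists a : X, pw X a (Datatypes.S n) <> pw X a n) ->
  (forall G phi, cons_4K A G phi -> S G phi) ->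
  (forall G phi, S G phi -> cons_w4K A G phi) ->
  (forall G phi, three_var_inputs G phi ->
    (S G phi -> halts_with P (enc_input G phi) 1) /\
    (~ S G phi -> halts_with P (enc_input G phi) 0)) ->
  False.
Proof.
  intros Ec Ec0 Ecy Ecbox Ecgoal Epre EG En EGn HA Hn Hl Hu HP.
  set (Q := diagonal pre P).
  (* The input [n] is the code of [G], which describes [Q] itself, so the builder produces the code
     of this very instance. *)
  assert (Henc : enc_input Gn goal_form =
    input_code cy cbox cgoal (Nat.iter n double_code c0) n).
  { rewrite EGn, enc_game_input, enc_num_form, <- Ec0, <- Ecy, <- Ecbox, <- Ecgoal, <- En.
    reflexivity. }
  destruct (exec_builder c0 cy cbox cgoal n) as (s & Hs & Hout & Hz).
  assert (Hpre : steps Q (init n) (length pre, s)).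
  { pose proof (compile_steps Q _ _ _ Hs eq_refl 0) as Hc. rewrite <- Epre in Hc.
    apply Hc. intros i Hi. unfold Q, diagonal. now apply nth_error_app1. }
  assert (Hnum : denotes_power (num_form c n) (start_number n)).
  { unfold start_number. rewrite <- Ec. apply num_form_denotes. }
  (* A match refutes consequence over finite models, hence [S]; without a match, consequence holds
     over all models, hence [S] does. *)
  assert (Hhalt : halts Q (init n) <-> ~ S Gn goal_form).
  { rewrite EGn, EG. split.
    - intros H HS. apply game_halts in H. destruct H as [N HN].
      exact (game_complete A _ _ _ N Hn Hnum HN (Hu _ _ HS)).
    - intros HS. apply NNPP. intros H. apply HS, Hl.
      apply (game_sound A (game_tiles Q) _ _ HA (game_tiles_nonempty Q) Hnum).
      intros HN. apply H. now apply game_halts. }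
  assert (H3 : three_var_inputs Gn goal_form).
  { rewrite EGn, EG. apply game_three_vars. }
  destruct (HP Gn goal_form H3) as [H1 H0].
  rewrite Henc in H1, H0.
  (* If [S] held, [P] would answer 1 and [Q] would halt, which refutes [S]. *)
  assert (HnS : ~ S Gn goal_form).
  { intros HS. apply (proj1 Hhalt); [|exact HS].
    destruct (diagonal_reaches_tail pre P n _ 1 s Hpre Hout Hz (H1 HS)) as (s' & Hs' & E).
    destruct (tail_halts pre P s' E) as (t & Ht & Hstop).
    exists t. split; [eapply steps_trans; eassumption | exact Hstop]. }
  (* As [S] fails, [P] answers 0 and [Q] loops at its tail, although [Hhalt] makes it halt. *)
  destruct (diagonal_reaches_tail pre P n _ 0 s Hpre Hout Hz (H0 HnS)) as (s' & Hs' & E).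
  apply (tail_loops pre P s' E).
  apply (halts_steps Q _ _ Hs'), Hhalt, HnS.
Qed.

(** Any [S] between the two consequence relations is allowed, so one argument covers both. *)
Lemma undecidable_three_vars (A : FLew -> Prop) (S : list form -> form -> Prop) :
  (forall X, A X -> weakly_archimedean X /\ linearly_ordered X) ->
  (forall n : nat, exists X, A X /\ exists a : X, pw X a (Datatypes.S n) <> pw X a n) ->
  (forall G phi, cons_4K A G phi -> S G phi) ->
  (forall G phi, S G phi -> cons_w4K A G phi) ->
  ~ decidable_on three_var_inputs S.
Proof.
  intros HA Hn Hl Hu [P HP].
  eapply (diagonal_contradiction A S P); try eassumption; reflexivity.
Qed.

Lemma decidable_on_restrict (D D' S : list form -> form -> Prop) :
  (forall G phi, D' G phi -> D G phi) -> decidable_on D S -> decidable_on D' S.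
Proof. intros H [P HP]. exists P. auto. Qed.

Lemma cons_4K_w4K A G phi : cons_4K A G phi -> cons_w4K A G phi.
Proof. intros H X W R e HX HW _. now apply H. Qed.

Theorem theorem3p1 (A : FLew -> Prop) :
  (forall X, A X -> weakly_archimedean X /\ linearly_ordered X) ->
  (forall n : nat, exists X, A X /\ exists a : X, pw X a (S n) <> pw X a n) ->
  (~ decidable_on all_inputs (cons_4K A)) /\
  (~ decidable_on all_inputs (cons_w4K A)) /\
  (~ decidable_on three_var_inputs (cons_4K A)) /\
  (~ decidable_on three_var_inputs (cons_w4K A)).
Proof.
  intros HA Hn.
  assert (H1 : ~ decidable_on three_var_inputs (cons_4K A))
    by (apply (undecidable_three_vars A); auto using cons_4K_w4K).
  assert (H2 : ~ decidable_on three_var_inputs (cons_w4K A))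
    by (apply (undecidable_three_vars A); auto using cons_4K_w4K).
  repeat split; try assumption; intros H.
  - now apply H1, (decidable_on_restrict all_inputs).
  - now apply H2, (decidable_on_restrict all_inputs).
Qed.
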